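(* Every finite-dimensional $C^*$-quantum groupoid can be deformed in such a way that the antipode becomes involutive on the Cartan subalgebras. That is, for every $C^*$-quantum groupoid $(A,\Delta,\kappa,\epsilon)$ there is an admissible element $k\in A_t$ such that the deformation $(A_k,\Delta_k,\kappa_k,\epsilon_k)$ is a $C^*$-quantum groupoid whose antipode satisfies $\kappa_k^2(x)=x$ for every $x$ in its target Cartan subalgebra and every $x$ in its source Cartan subalgebra.
   Context: A $C^*$-quantum groupoid (weak Hopf $C^*$-algebra) is a collection $(A,\Delta,\kappa,\epsilon)$ where: $A$ is a finite-dimensional (unital) $C^*$-algebra; $\Delta:A\to A\otimes A$ is a $*$-homomorphism, not necessarily unital, with $(\Delta\otimes i)\Delta=(i\otimes\Delta)\Delta$ ($i$ = identity map); $\kappa:A\to A$ (antipode) is linear with $(\kappa\circ * )^2=i$, $\kappa(xy)=\kappa(y)\kappa(x)$ for all $x,y\in A$, $(\kappa\otimes\kappa)\Delta=\varsigma\Delta\kappa$ ($\varsigma$ the flip on $A\otimes A$), and $(m(\kappa\otimes i)\otimes i)(\Delta\otimes i)\Delta(x)=(1\otimes x)\Delta(1)$ for all $x\in A$, where $m(a\otimes b)=ab$; $\epsilon$ (counit) is a positive linear form on $A$ with $(\epsilon\otimes i)\Delta=(i\otimes\epsilon)\Delta=i$ and $(\epsilon\otimes\epsilon)((x\otimes 1)\Delta(1)(1\otimes y))=\epsilon(xy)$ for all $x,y\in A$. The target and source Cartan subalgebras are the $C^*$-subalgebras $A_t=\{x\in A:\Delta(x)=\Delta(1)(x\otimes 1)=(x\otimes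 1)\Delta(1)\}$ and $A_s=\{x\in A:\Delta(x)=\Delta(1)(1\otimes x)=(1\otimes x)\Delta(1)\}$. For a finite-dimensional $C^*$-algebra $N\cong\bigoplus_\gamma M_{n_\gamma}(\mathbb C)$ with a system of matrix units $\{e^\gamma_{i,j}:1\le i,j\le n_\gamma\}$, $E_{Z(N)}:N\to Z(N)$ is the canonical conditional expectation onto the center, $E_{Z(N)}(n)=\sum_{\gamma,i,j}\frac1{n_\gamma}e^\gamma_{i,j}\,n\,e^\gamma_{j,i}$. The canonical element of $(A,\Delta,\kappa,\epsilon)$ is the unique invertible element $q\in A_t$ such that, for any system of matrix units $(e^\gamma_{i,j})$ of $A_t\cong\bigoplus_\gamma M_{n_\gamma}(\mathbb C)$, $\Delta(1)=\sum_\gamma\sum_{i,j}\frac1{n_\gamma}\kappa^{-1}(e^\gamma_{i,j}q)\otimes e^\gamma_{j,i}$; such an element exists, is positive, and satisfies $\kappa^2(q)=q$, $E_{Z(A_t)}(q)=1$, and $\kappa^2(x)=q^{-1}\kappa(q)xq\kappa(q^{-1})$ for all $x$ in the algebra generated by $A_t$ and $A_s$. Call $k\in A_t$ admissible if it is positive and invertible, $\kappa^2(k)=k$, and $E_{Z(A_t)}(k^{-1}q)=1$. The deformation of $(A,\Delta,\kappa,\epsilon)$ by an admissible $k$ is $(A_k,\Delta_k,\kappa_k,\epsilon_k)$, where $A_k$ is the algebra $A$ with involution $a^{*_k}=ka^*k^{-1}$, and $\Delta_k(a)=\Delta(a)(1\otimes k^{-1})$, $\kappa_k(a)=k\kappa(a)k^{-1}$,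 $\epsilon_k(a)=\epsilon(ak)$ for $a\in A$. *)

(* Defs.v *)
(* The complex numbers are [R[i]] with [R : realType], and finite-dimensional
   unital complex algebras are [falgType R[i]]. *)
From HB Require Import structures.
From mathcomp Require Import all_boot all_order all_algebra all_field.
From mathcomp Require Import reals complex.

Set Implicit Arguments.
Unset Strict Implicit.
Unset Printing Implicit Defensive.

Import Order.TTheory GRing.Theory Num.Theory.

Local Open Scope ring_scope.

(** * Tensor products of finite-dimensional spaces and algebras *)

(* An element of [tensor U V] is the matrix of its coordinates in the basis
   [e_i ⊗ f_j], where [(e_i)] and [(f_j)] are the bases [vbasis {:U}] and
   [vbasis {:V}].  The lemmas [tens_linear_l], [tens_linear_r], [tens_expand],
   [tlift_linear] and [tlift_tens] below give the universal property. *)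
Definition tensor (F : fieldType) (U V : vectType F) : predArgType :=
  'M[F]_(\dim {:U}, \dim {:V}).

HB.instance Definition _ (F : fieldType) (U V : vectType F) :=
  Vector.copy (tensor U V) 'M[F]_(\dim {:U}, \dim {:V}).

Definition tens (F : fieldType) (U V : vectType F) (u : U) (v : V) :
    tensor U V :=
  \matrix_(i, j) (coord (vbasis {:U}) i u * coord (vbasis {:V}) j v).

Notation "u ⊗ v" := (tens u v) (at level 40, left associativity) : ring_scope.

(* [tlift f] is the linear map on [tensor U V] sending [u ⊗ v] to [f u v] when
   [f] is bilinear. *)
Definition tlift (F : fieldType) (U V : vectType F) (W : lmodType F)
    (f : U -> V -> W) (z : tensor U V) : W :=
  \sum_i \sum_j (z : 'M_(\dim {:U}, \dim {:V})) i j *: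
    f (vbasis {:U})`_i (vbasis {:V})`_j.

Lemma tens_linear_l (F : fieldType) (U V : vectType F) (v : V) :
  linear (fun u : U => u ⊗ v).
Proof.
move=> a x y; apply/matrixP => i j.
by rewrite !mxE linearP /= mulrDl mulrA.
Qed.

Lemma tens_linear_r (F : fieldType) (U V : vectType F) (u : U) :
  linear (fun v : V => u ⊗ v).
Proof.
move=> a x y; apply/matrixP => i j.
by rewrite !mxE linearP /= mulrDr mulrCA.
Qed.

Lemma tlift_linear (F : fieldType) (U V : vectType F) (W : lmodType F)
    (f : U -> V -> W) : linear (tlift f).
Proof.
move=> a x y; rewrite /tlift scaler_sumr -big_split; apply: eq_bigr => i _ /=.
rewrite scaler_sumr -big_split; apply: eq_bigr => j _ /=.
by rewrite !mxE scalerDl scalerA.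
Qed.

Lemma coord_vbasis_nth (F : fieldType) (U : vectType F)
    (i j : 'I_(\dim {:U})) :
  coord (vbasis {:U}) i (vbasis {:U})`_j = (i == j)%:R.
Proof. by rewrite (coord_free _ _ (basis_free (vbasisP _))) eq_sym. Qed.

Lemma tens_expand (F : fieldType) (U V : vectType F) (z : tensor U V) :
  z = tlift (fun u v => u ⊗ v) z.
Proof.
rewrite /tlift {1}[z]matrix_sum_delta; apply: eq_bigr => i _.
apply: eq_bigr => j _; congr (_ *: _); apply/matrixP => k l.
by rewrite !mxE !coord_vbasis_nth -natrM mulnb.
Qed.

Lemma linear_sumE (F : fieldType) (U W : lmodType F) (f : U -> W)
    (I : finType) (c : I -> F) (x : I -> U) :
  linear f -> f (\sum_i c i *: x i) = \sum_i c i *: f (x i).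
Proof.
move=> fl; have f0 : f 0 = 0.
  by have := fl (-1) 0 0; rewrite scaler0 addr0 scaleN1r addNr.
by elim/big_rec2: _ => // i y1 y2 _ <-; rewrite fl.
Qed.

Lemma tlift_tens (F : fieldType) (U V : vectType F) (W : lmodType F)
    (f : U -> V -> W) (u : U) (v : V) :
  (forall y, linear (fun x => f x y)) -> (forall x, linear (f x)) ->
  tlift f (u ⊗ v) = f u v.
Proof.
move=> fl fr; rewrite /tlift [in RHS](coord_vbasis (memvf u)) (linear_sumE _ _ (fl v)).
apply: eq_bigr => i _.
rewrite [in RHS](coord_vbasis (memvf v)) (linear_sumE _ _ (fr _)) scaler_sumr.
by apply: eq_bigr => j _; rewrite scalerA mxE.
Qed.

Lemma tens_ind (F : fieldType) (U V : vectType F) (P : tensor U V -> Prop) :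
  (forall a x y, P x -> P y -> P (a *: x + y)) -> (forall u v, P (u ⊗ v)) ->
  forall z, P z.
Proof.
move=> PD Pt z; have P0 : P 0.
  by have := PD (-1) (0 ⊗ 0) (0 ⊗ 0) (Pt _ _) (Pt _ _); rewrite scaleN1r addNr.
have PS (x y : tensor U V) : P x -> P y -> P (x + y).
  by rewrite -{2}[x]scale1r; apply: PD.
rewrite [z]tens_expand; apply: big_ind => // i _; apply: big_ind => // j _.
by rewrite -[X in P X]addr0; apply: PD.
Qed.

(** The tensor product of two finite-dimensional algebras *)

Definition tmul (F : fieldType) (A B : falgType F) (x y : tensor A B) :
    tensor A B :=
  tlift (fun a b => tlift (fun c d => (a * c) ⊗ (b * d)) y) x.

Lemma tmul_linear_l (F : fieldType) (A B : falgType F) (y : tensor A B) :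
  linear (fun x => tmul x y).
Proof. exact: tlift_linear. Qed.

Lemma tmul_linear_r (F : fieldType) (A B : falgType F) (x : tensor A B) :
  linear (tmul x).
Proof.
move=> a y z; rewrite /tmul [tlift _ x]/tlift.
under eq_bigr do under eq_bigr do rewrite tlift_linear.
rewrite /tlift scaler_sumr -big_split.
apply: eq_bigr => i _ /=; rewrite scaler_sumr -big_split.
by apply: eq_bigr => j _ /=; rewrite scalerDr !scalerA mulrC.
Qed.

Lemma tmul_tens (F : fieldType) (A B : falgType F) (a c : A) (b d : B) :
  tmul (a ⊗ b) (c ⊗ d) = (a * c) ⊗ (b * d).
Proof.
have step (a' : A) (b' : B) :
    tlift (fun c d => (a' * c) ⊗ (b' * d)) (c ⊗ d) = (a' * c) ⊗ (b' * d).
  apply: tlift_tens => [y|x] k u v.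
    by rewrite mulrDr -scalerAr tens_linear_l.
  by rewrite mulrDr -scalerAr tens_linear_r.
rewrite /tmul tlift_tens // => [y|x] k u v; rewrite !step.
  by rewrite mulrDl -scalerAl tens_linear_l.
by rewrite mulrDl -scalerAl tens_linear_r.
Qed.

Lemma tmulA (F : fieldType) (A B : falgType F) : associative (@tmul F A B).
Proof.
move=> x y z; elim/tens_ind: x => [k x1 x2 IH1 IH2|a b].
  by rewrite !tmul_linear_l IH1 IH2.
elim/tens_ind: y => [k y1 y2 IH1 IH2|c d].
  by rewrite tmul_linear_l !tmul_linear_r tmul_linear_l IH1 IH2.
elim/tens_ind: z => [k z1 z2 IH1 IH2|e f]; first by rewrite !tmul_linear_r IH1 IH2.
by rewrite !tmul_tens !mulrA.
Qed.

Lemma tmul1x (F : fieldType) (A B : falgType F) :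
  left_id ((1 : A) ⊗ (1 : B)) (@tmul F A B).
Proof.
elim/tens_ind => [k x1 x2 IH1 IH2|a b]; last by rewrite tmul_tens !mul1r.
by rewrite tmul_linear_r IH1 IH2.
Qed.

Lemma tmulx1 (F : fieldType) (A B : falgType F) :
  right_id ((1 : A) ⊗ (1 : B)) (@tmul F A B).
Proof.
elim/tens_ind => [k x1 x2 IH1 IH2|a b]; last by rewrite tmul_tens !mulr1.
by rewrite tmul_linear_l IH1 IH2.
Qed.

Lemma tmulDl (F : fieldType) (A B : falgType F) :
  left_distributive (@tmul F A B) +%R.
Proof. by move=> x y z; have := tmul_linear_l z 1 x y; rewrite !scale1r. Qed.

Lemma tmulDr (F : fieldType) (A B : falgType F) :
  right_distributive (@tmul F A B) +%R.
Proof. by move=> x y z; have := tmul_linear_r x 1 y z; rewrite !scale1r. Qed.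

Lemma tens_neq0 (F : fieldType) (U V : vectType F) (u : U) (v : V) :
  u != 0 -> v != 0 -> u ⊗ v != 0.
Proof.
have nz (W : vectType F) (w : W) :
    w != 0 -> exists i, coord (vbasis {:W}) i w != 0.
  move=> w0; apply/existsP; apply: contraNT w0; rewrite negb_exists.
  move=> /forallP w0; rewrite (coord_vbasis (memvf w)) big1 // => i _.
  by have := w0 i; rewrite negbK => /eqP ->; rewrite scale0r.
move=> /nz[i ui] /nz[j vj]; apply/eqP => /matrixP/(_ i j) /eqP.
by rewrite !mxE mulf_eq0 (negbTE ui) (negbTE vj).
Qed.

Lemma tone_neq0 (F : fieldType) (A B : falgType F) :
  (1 : A) ⊗ (1 : B) != 0.
Proof. by apply: tens_neq0; exact: oner_neq0. Qed.

HB.instance Definition _ (F : fieldType) (A B : falgType F) :=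
  GRing.Zmodule_isNzRing.Build (tensor A B)
    (@tmulA F A B) (@tmul1x F A B) (@tmulx1 F A B)
    (@tmulDl F A B) (@tmulDr F A B) (tone_neq0 A B).

Lemma tens_mul (F : fieldType) (A B : falgType F) (a c : A) (b d : B) :
  (a ⊗ b) * (c ⊗ d) = (a * c) ⊗ (b * d).
Proof. exact: tmul_tens. Qed.

Lemma tens11 (F : fieldType) (A B : falgType F) :
  (1 : tensor A B) = 1 ⊗ 1.
Proof. by []. Qed.

Lemma tscaleAl (F : fieldType) (A B : falgType F) (k : F) (x y : tensor A B) :
  k *: (x * y) = (k *: x) * y.
Proof.
have ml : linear (fun z : tensor A B => z * y) := tmul_linear_l y.
by rewrite -[k *: x]addr0 ml mul0r addr0.
Qed.

HB.instance Definition _ (F : fieldType) (A B : falgType F) :=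
  GRing.Lmodule_isLalgebra.Build F (tensor A B) (@tscaleAl F A B).

Lemma tscaleAr (F : fieldType) (A B : falgType F) (k : F) (x y : tensor A B) :
  k *: (x * y) = x * (k *: y).
Proof.
have ml : linear (fun z : tensor A B => x * z) := tmul_linear_r x.
by rewrite -[k *: y]addr0 ml mulr0 addr0.
Qed.

HB.instance Definition _ (F : fieldType) (A B : falgType F) :=
  GRing.Lalgebra_isAlgebra.Build F (tensor A B) (@tscaleAr F A B).

HB.instance Definition _ (F : fieldType) (A B : falgType F) :=
  Algebra_isFalgebra.Build F (tensor A B).

(** Canonical maps between tensor products *)

Definition tmap (F : fieldType) (U V U' V' : vectType F)
    (f : U -> U') (g : V -> V') : tensor U V -> tensor U' V' :=
  tlift (fun u v => f u ⊗ g v).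

Definition tflip (F : fieldType) (U V : vectType F) :
    tensor U V -> tensor V U :=
  tlift (fun u v => v ⊗ u).

Definition tassoc (F : fieldType) (U V W : vectType F) :
    tensor (tensor U V) W -> tensor U (tensor V W) :=
  tlift (fun uv w => tlift (fun u v => u ⊗ (v ⊗ w)) uv).

(* The multiplication [m : A ⊗ A -> A]. *)
Definition tmult (F : fieldType) (A : falgType F) : tensor A A -> A :=
  tlift (fun a b => a * b).

Lemma tmap_tens (F : fieldType) (U V U' V' : vectType F)
    (f : 'Hom(U, U')) (g : 'Hom(V, V')) (u : U) (v : V) :
  tmap f g (u ⊗ v) = f u ⊗ g v.
Proof.
by rewrite /tmap tlift_tens // => [y|x] k a b;
  rewrite linearP ?tens_linear_l ?tens_linear_r.
Qed.

Lemma tflip_tens (F : fieldType) (U V : vectType F) (u : U) (v : V) :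
  tflip (u ⊗ v) = v ⊗ u.
Proof.
by rewrite /tflip tlift_tens // => [y|x] k a b;
  rewrite ?tens_linear_l ?tens_linear_r.
Qed.

Lemma tassoc_tens (F : fieldType) (U V W : vectType F)
    (u : U) (v : V) (w : W) :
  tassoc (u ⊗ v ⊗ w) = u ⊗ (v ⊗ w).
Proof.
have step (w' : W) (u' : U) (v' : V) :
    tlift (fun a b => a ⊗ (b ⊗ w')) (u' ⊗ v') = u' ⊗ (v' ⊗ w').
  by rewrite tlift_tens // => [y|x] k a b;
    rewrite ?tens_linear_l ?tens_linear_r.
rewrite /tassoc tlift_tens ?step // => [y|x] k a b; first exact: tlift_linear.
rewrite /tlift scaler_sumr -big_split; apply: eq_bigr => i _ /=.
rewrite scaler_sumr -big_split; apply: eq_bigr => j _ /=.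
by rewrite !tens_linear_r scalerDr !scalerA mulrC.
Qed.

Lemma tmult_tens (F : fieldType) (A : falgType F) (a b : A) :
  tmult (a ⊗ b) = a * b.
Proof.
by rewrite /tmult tlift_tens // => [y|x] k u v;
  rewrite ?mulrDl ?mulrDr -?scalerAl -?scalerAr.
Qed.

(* The antilinear map [a ⊗ b |-> a^* ⊗ b^*]. *)
Definition tstar (R : realType) (A B : falgType R[i])
    (sA : A -> A) (sB : B -> B) (z : tensor A B) : tensor A B :=
  tlift (fun a b => sA a ⊗ sB b)
    (map_mx Num.conj (z : 'M_(\dim {:A}, \dim {:B})) : tensor A B).

Lemma tstar_tens (R : realType) (A B : falgType R[i])
    (sA : A -> A) (sB : B -> B) (a : A) (b : B) :
  (forall c x y, sA (c *: x + y) = Num.conj c *: sA x + sA y) ->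
  (forall c x y, sB (c *: x + y) = Num.conj c *: sB x + sB y) ->
  tstar sA sB (a ⊗ b) = sA a ⊗ sB b.
Proof.
have semi (D : falgType R[i]) (s : D -> D) (I : finType) (c : I -> R[i])
    (x : I -> D) : (forall c x y, s (c *: x + y) = Num.conj c *: s x + s y) ->
    s (\sum_i c i *: x i) = \sum_i Num.conj (c i) *: s (x i).
  move=> sl; have s0 : s 0 = 0.
    have := sl (-1) 0 0.
    by rewrite scaler0 addr0 rmorphN rmorph1 scaleN1r addNr.
  by elim/big_rec2: _ => // i y1 y2 _ <-; rewrite sl.
move=> sAl sBl; rewrite /tstar /tlift.
rewrite [in RHS](coord_vbasis (memvf a)) [in RHS](coord_vbasis (memvf b)).
rewrite !semi // (linear_sumE _ _ (tens_linear_l _)); apply: eq_bigr => i _.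
rewrite (linear_sumE _ _ (tens_linear_r _)) scaler_sumr.
by apply: eq_bigr => j _; rewrite !mxE rmorphM scalerA.
Qed.

(** * Finite-dimensional C*-algebras *)

Record is_cstar_norm (R : realType) (A : falgType R[i]) (star : A -> A)
    (nrm : A -> R) : Prop := IsCstarNorm {
  cstar_norm_ge0 : forall x, 0 <= nrm x;
  cstar_norm_eq0 : forall x, nrm x = 0 -> x = 0;
  cstar_normD : forall x y, nrm (x + y) <= nrm x + nrm y;
  cstar_normZ : forall c x, ((nrm (c *: x))%:C)%C = `|c| * ((nrm x)%:C)%C;
  cstar_normM : forall x y, nrm (x * y) <= nrm x * nrm y;
  cstar_norm_star : forall x, nrm (star x * x) = nrm x ^+ 2 }.

(* Completeness of the norm is automatic in finite dimension, and a C*-norm is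
   unique, so being a C*-algebra is a property of the involution. *)
Record is_cstar_algebra (R : realType) (A : falgType R[i]) (star : A -> A) :
    Prop := IsCstarAlgebra {
  star_additive : forall x y, star (x + y) = star x + star y;
  star_scale : forall c x, star (c *: x) = Num.conj c *: star x;
  star_involutive : forall x, star (star x) = x;
  star_antimul : forall x y, star (x * y) = star y * star x;
  cstar_norm_exists : exists nrm : A -> R, is_cstar_norm star nrm }.

Definition cstar_positive (R : realType) (A : falgType R[i]) (star : A -> A)
    (x : A) : Prop :=
  exists y, x = star y * y.

(** * C*-quantum groupoids *)

Record is_quantum_groupoid (R : realType) (A : falgType R[i]) (star : A -> A)
    (Delta : 'Hom(A, tensor A A)) (kappa : 'End(A))
    (eps : 'Hom(A, (R[i])^o)) : Prop := IsQuantumGroupoid {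
  qg_cstar : is_cstar_algebra star;
  qg_Delta_mul : forall x y, Delta (x * y) = Delta x * Delta y;
  qg_Delta_star : forall x, Delta (star x) = tstar star star (Delta x);
  qg_coassoc : forall x,
    tassoc (tmap Delta id (Delta x)) = tmap id Delta (Delta x);
  qg_kappa_star : forall x, kappa (star (kappa (star x))) = x;
  qg_kappa_mul : forall x y, kappa (x * y) = kappa y * kappa x;
  qg_kappa_Delta : forall x,
    tmap kappa kappa (Delta x) = tflip (Delta (kappa x));
  qg_antipode : forall x,
    tmap (fun z => tmult (tmap kappa id z)) id (tmap Delta id (Delta x)) =
    (1 ⊗ x) * Delta 1;
  qg_eps_pos : forall x, cstar_positive star x -> 0 <= (eps x : R[i]);
  qg_counit_l : forall x, tlift (fun a b => (eps a : R[i]) *: b) (Delta x) = x;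
  qg_counit_r : forall x, tlift (fun a b => (eps b : R[i]) *: a) (Delta x) = x;
  qg_eps_mul : forall x y,
    tlift (fun a b => eps a * eps b) ((x ⊗ 1) * Delta 1 * (1 ⊗ y)) =
    eps (x * y) }.

Definition target (R : realType) (A : falgType R[i])
    (Delta : 'Hom(A, tensor A A)) (x : A) : Prop :=
  Delta x = Delta 1 * (x ⊗ 1) /\ Delta 1 * (x ⊗ 1) = (x ⊗ 1) * Delta 1.

Definition source (R : realType) (A : falgType R[i])
    (Delta : 'Hom(A, tensor A A)) (x : A) : Prop :=
  Delta x = Delta 1 * (1 ⊗ x) /\ Delta 1 * (1 ⊗ x) = (1 ⊗ x) * Delta 1.

(** * Matrix units, the canonical element, and deformations *)

(* A system of matrix units of a unital C*-subalgebra [N] of [A], i.e., the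
   image of the elementary matrices under a *-isomorphism from
   [\bigoplus_g 'M_(n g)] to [N].  Linear independence of the [e g i j]
   follows from the other clauses. *)
Record is_matrix_units (R : realType) (A : falgType R[i]) (star : A -> A)
    (N : A -> Prop) (r : nat) (n : 'I_r -> nat)
    (e : forall g, 'I_(n g) -> 'I_(n g) -> A) : Prop := IsMatrixUnits {
  mxu_size : forall g, (0 < n g)%N;
  mxu_mem : forall g i j, N (e g i j);
  mxu_neq0 : forall g i j, e g i j != 0;
  mxu_star : forall g i j, star (e g i j) = e g j i;
  mxu_mul : forall g i j k l,
    e g i j * e g k l = if j == k then e g i l else 0;
  mxu_mul0 : forall g h i j k l, g != h -> e g i j * e h k l = 0;
  mxu_span : forall x, N x -> exists c : forall g, 'I_(n g) -> 'I_(n g) -> R[i],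
    x = \sum_g \sum_i \sum_j c g i j *: e g i j }.

Definition center_expectation (R : realType) (A : falgType R[i])
    (r : nat) (n : 'I_r -> nat)
    (e : forall g, 'I_(n g) -> 'I_(n g) -> A) (x : A) : A :=
  \sum_g \sum_i \sum_j (n g)%:R^-1 *: (e g i j * x * e g j i).

(* [(kappa^-1)%VF] is the inverse linear map; [kappa] is bijective by
   [qg_kappa_star]. *)
Definition is_canonical_element (R : realType) (A : falgType R[i])
    (star : A -> A) (Delta : 'Hom(A, tensor A A)) (kappa : 'End(A)) (q : A) :
    Prop :=
  [/\ target Delta q, q \is a GRing.unit &
    forall (r : nat) (n : 'I_r -> nat)
        (e : forall g, 'I_(n g) -> 'I_(n g) -> A),
      is_matrix_units star (target Delta) e ->
      Delta 1 = \sum_g \sum_i \sum_j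
        (n g)%:R^-1 *: ((kappa^-1)%VF (e g i j * q) ⊗ e g j i)].

(* [center_expectation e] does not depend on the system [e] of matrix units. *)
Definition admissible (R : realType) (A : falgType R[i]) (star : A -> A)
    (Delta : 'Hom(A, tensor A A)) (kappa : 'End(A)) (k : A) : Prop :=
  [/\ target Delta k, cstar_positive star k, k \is a GRing.unit,
      kappa (kappa k) = k &
    exists2 q, is_canonical_element star Delta kappa q &
      forall (r : nat) (n : 'I_r -> nat)
          (e : forall g, 'I_(n g) -> 'I_(n g) -> A),
        is_matrix_units star (target Delta) e ->
        center_expectation e (k^-1 * q) = 1].

Definition deform_star (R : realType) (A : falgType R[i]) (star : A -> A)
    (k : A) : A -> A :=
  fun a => k * star a * k^-1.

Definition deform_Delta (R : realType) (A : falgType R[i])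
    (Delta : 'Hom(A, tensor A A)) (k : A) : 'Hom(A, tensor A A) :=
  (amulr (1 ⊗ k^-1)%R \o Delta)%VF.

Definition deform_kappa (R : realType) (A : falgType R[i])
    (kappa : 'End(A)) (k : A) : 'End(A) :=
  (amulr (k^-1)%R \o amull k \o kappa)%VF.

Definition deform_eps (R : realType) (A : falgType R[i])
    (eps : 'Hom(A, (R[i])^o)) (k : A) : 'Hom(A, (R[i])^o) :=
  (eps \o amulr k)%VF.

Lemma deform_DeltaE (R : realType) (A : falgType R[i])
    (Delta : 'Hom(A, tensor A A)) (k a : A) :
  deform_Delta Delta k a = Delta a * (1 ⊗ k^-1).
Proof. by rewrite comp_lfunE lfunE. Qed.

Lemma deform_kappaE (R : realType) (A : falgType R[i])
    (kappa : 'End(A)) (k a : A) :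
  deform_kappa kappa k a = k * kappa a * k^-1.
Proof. by rewrite !comp_lfunE !lfunE. Qed.

Lemma deform_epsE (R : realType) (A : falgType R[i])
    (eps : 'Hom(A, (R[i])^o)) (k a : A) :
  deform_eps eps k a = eps (a * k).
Proof. by rewrite comp_lfunE lfunE. Qed.

(* Main.v *)
(* The canonical element [q] is itself admissible, since [E (q^-1 q) = E 1 = 1],
   and deforming by it works: [kappa^2 x = q^-1 kappa(q) x q kappa(q)^-1] on both
   Cartan subalgebras, which the two conjugations in [kappa_q^2] undo because
   [A_t] and [A_s] commute.

   To obtain [q] without the structure theory of C*-algebras, note that the
   counit is a faithful positive form on [A_t].  For a family [(f)] in [A_t] with
   [z = \sum_f eps (f^* z) f] on [A_t] one gets
   [Delta 1 = \sum_f kappa^-1 (f) ⊗ f^*], and [q = \sum_f f^* f].  Then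
   [\sum_f f q^-1 f^* = 1] holds, which is what the deformed axioms need, and [q]
   has a square root because its annihilating polynomial may be taken to have
   simple positive roots. *)
Require Import Defs.
From HB Require Import structures.
From mathcomp Require Import all_boot all_order all_algebra all_field.
From mathcomp Require Import reals complex ring.

Set Implicit Arguments.
Unset Strict Implicit.
Unset Printing Implicit Defensive.

Import Order.TTheory GRing.Theory Num.Theory.
Local Open Scope ring_scope.

(** * Square roots of positive elements *)

(** Faithfulness of the counit on A_t comes from a reproducing property: every z in A_t is a
    combination of the right legs of Delta(1) with coefficients eps(e_i z), and the degenerate case
    of Cauchy-Schwarz annihilates all of them when eps(z^* z) = 0. This form does the work usually
    done by the norm, so the argument runs over any [numClosedFieldType]; the norm returns only to
    show that the deformed involution is again a C*-involution. Moving elements of A_t through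
    Delta(1) shows that \sum_f f ⊗ f^* is a Casimir tensor of A_t. Any Casimir tensor \sum_k a_k ⊗
    b_k with \sum_k a_k b_k = 1 becomes this one once a_k is replaced by a_k q, and that is how the
    required formula for Delta(1) follows for each given system of matrix units. *)

Lemma poly_interpolation (F : fieldType) (s : seq F) (g : F -> F) :
  uniq s -> exists r : {poly F}, forall a, a \in s -> r.[a] = g a.
Proof.
elim: s => [|b s IH] /=; first by exists 0.
case/andP=> bs /IH[r rE]; pose P := \prod_(a <- s) ('X - a%:P).
have Pb : P.[b] != 0 by rewrite -[_ == 0]/(root P b) root_prod_XsubC.
exists (r + ((g b - r.[b]) / P.[b]) *: P) => a; rewrite inE hornerD hornerZ.
case/orP=> [/eqP ->|ias]; first by rewrite divfK // addrC subrK.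
have /eqP -> : P.[a] == 0 by rewrite -[_ == 0]/(root P a) root_prod_XsubC.
by rewrite mulr0 addr0 rE.
Qed.

(** Dimension count: polynomials with dim A + 1 coefficients cannot evaluate injectively at x. *)
Lemma annihilating_poly (F : fieldType) (A : falgType F) (x : A) :
  exists2 p : {poly F}, p != 0 & horner_alg x p = 0.
Proof.
pose n := (\dim {:A}).+1.
pose ev (u : 'rV[F]_n) := horner_alg x (rVpoly u).
have ev_lin : linear ev.
  by move=> a u v; rewrite /ev linearP /= linearP /= mulr_algl.
pose evM := GRing.isLinear.Build _ _ _ _ ev ev_lin.
pose evL : {linear 'rV[F]_n -> A} := HB.pack ev evM.
have : lker (linfun evL) != 0%VS.
  apply/eqP => k0; have := limg_ker_dim (linfun evL) fullv.
  rewrite k0 capv0 dimv0 add0n => dI.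
  have := dimvS (subvf (limg (linfun evL))).
  by rewrite dI dimvf /dim /= mul1n ltnn.
rewrite -vpick0; set u := vpick _ => u0; exists (rVpoly u).
  by apply: contra u0 => /eqP pu; rewrite -(rVpolyK u) pu raddf0.
by have := memv_pick (lker (linfun evL)); rewrite memv_ker lfunE => /eqP.
Qed.

(** * Positive functionals: Cauchy-Schwarz and frames *)

Section PositiveFunctional.
Variables (C : numClosedFieldType) (A : falgType C) (star : A -> A).
Hypothesis starD : {morph star : x y / x + y}.
Hypothesis starZ : forall c x, star (c *: x) = c^* *: star x.
Hypothesis starK : involutive star.
Hypothesis starM : forall x y, star (x * y) = star y * star x.

Lemma star0 : star 0 = 0.
Proof. by rewrite -[X in star X](scale0r 0) starZ conjC0 scale0r. Qed.

Lemma star1 : star 1 = 1.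
Proof. by rewrite -[LHS]mul1r -{1}[1]starK -starM mul1r starK. Qed.

Lemma starN : {morph star : x / - x}.
Proof. by move=> x; rewrite -!scaleN1r starZ rmorphN1. Qed.

Lemma starB : {morph star : x y / x - y}.
Proof. by move=> x y; rewrite starD starN. Qed.

Lemma star_sum (I : Type) (r : seq I) (F : I -> A) :
  star (\sum_(i <- r) F i) = \sum_(i <- r) star (F i).
Proof. by apply: big_morph; [exact: starD | exact: star0]. Qed.

Lemma starV x : x \is a GRing.unit -> star x^-1 = (star x)^-1.
Proof.
move=> xU; have e1 : star x * star x^-1 = 1 by rewrite -starM mulVr ?star1.
have e2 : star x^-1 * star x = 1 by rewrite -starM mulrV ?star1.
have sU : star x \is a GRing.unit by apply/unitrP; exists (star x^-1).
by rewrite -[LHS](mulKr sU) e1 mulr1.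
Qed.

Lemma star_horner_alg q (p : {poly C}) :
  star q = q -> star (horner_alg q p) = horner_alg q (map_poly Num.conj p).
Proof.
move=> qs; elim/poly_ind: p => [|p c IH]; first by rewrite !rmorph0 star0.
rewrite !rmorphD !rmorphM /= map_polyX map_polyC /= !horner_algX !horner_algC.
rewrite starD starM IH starZ star1 qs; congr (_ + _).
have cX : GRing.comm (horner_alg q (map_poly Num.conj p)) q.
  by rewrite /GRing.comm -{2 3}(horner_algX q) -!rmorphM /= mulrC.
by rewrite cX.
Qed.

(* [N] is a *-subalgebra on which the positive functional [eps] is faithful. *)
Variables (eps : {linear A -> C^o}) (N : A -> Prop).
Hypothesis eps_ge0 : forall x, 0 <= eps (star x * x) :> C.
Hypothesis N1 : N 1.
Hypothesis NP : forall c x y, N x -> N y -> N (c *: x + y).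
Hypothesis NM : forall x y, N x -> N y -> N (x * y).
Hypothesis eps_faithful : forall x, N x -> eps (star x * x) = 0 -> x = 0.

Let N0 : N 0.
Proof. by have := NP (-1) N1 N1; rewrite scaleN1r addNr. Qed.

Let ND x y : N x -> N y -> N (x + y).
Proof. by move=> Nx Ny; rewrite -[x]scale1r; apply: NP. Qed.

Let NZ c x : N x -> N (c *: x).
Proof. by move=> Nx; rewrite -[_ *: _]addr0; apply: NP. Qed.

Lemma mem_horner_alg q (p : {poly C}) : N q -> N (horner_alg q p).
Proof.
move=> Nq; elim/poly_ind: p => [|p c IH]; first by rewrite rmorph0.
rewrite !rmorphD !rmorphM /= horner_algX horner_algC.
by apply: ND; [apply: NM | apply: NZ].
Qed.

Lemma eps_gt0 x : N x -> x != 0 -> 0 < eps (star x * x) :> C.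
Proof.
move=> Nx x0; rewrite lt_def eps_ge0 andbT.
by apply: contraNneq x0 => /(eps_faithful Nx) ->.
Qed.

Let eps_expand c x y : eps (star (x + c *: y) * (x + c *: y)) =
  eps (star x * x) + (c * eps (star x * y) + c^* * eps (star y * x))
  + c * c^* * eps (star y * y) :> C.
Proof.
rewrite starD starZ mulrDl !mulrDr -!scalerAl -!scalerAr !linearD /=.
rewrite !linearZ /= /GRing.scale /=; ring.
Qed.

(** Polarization: c eps(x^* y) + conj(c) eps(y^* x) is real for every c, and the cases c = 1 and c =
    i together give the claim. *)
Lemma eps_hermitian x y : eps (star y * x) = (eps (star x * y) : C)^* :> C.
Proof.
set a : C := eps (star x * y); set b : C := eps (star y * x).
have real_ab c : (c * a + c^* * b)^* = c * a + c^* * b.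
  apply/CrealP; have -> : c * a + c^* * b = eps (star (x + c *: y) * (x + c *: y))
      - eps (star x * x) - c * c^* * eps (star y * y).
    by rewrite eps_expand; ring.
  have h u : (eps (star u * u) : C) \is Num.real by rewrite ger0_real.
  by rewrite !rpredB ?h // rpredM ?h // ger0_real // mul_conjC_ge0.
have := real_ab 1; have := real_ab 'i.
rewrite !rmorphD !rmorphM /= !conjCK conjCi conjC1 !mul1r => ei e1.
have {}ei : b^* - a^* = a - b.
  by apply: (mulfI (neq0Ci C)); rewrite !mulrBr -mulNr addrC ei mulNr.
apply: (can_inj (@conjCK _)); rewrite conjCK.
apply: (mulfI (x := 2%:R)); first by rewrite pnatr_eq0.
transitivity (a^* + b^* + (b^* - a^*)); first by ring.
by rewrite e1 ei; ring.
Qed.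

Lemma eps_star x : eps (star x) = (eps x : C)^* :> C.
Proof. by have := eps_hermitian 1 x; rewrite mulr1 star1 mul1r. Qed.

Lemma eps_cauchy_schwarz0 a z : eps (star z * z) = 0 -> eps (a * z) = 0.
Proof.
move=> z0; rewrite -[a]starK; set w := star a.
set b : C := eps (star w * z); have [//|b0] := eqVneq b 0.
(* As eps(z^* z) = 0, the form at w + c z is affine in c over the reals. This c makes c * b real,
   equal to -(eps(w^* w) + 1)/2, and the form takes the value -1. *)
pose c := - (eps (star w * w) + 1) / 2%:R / b.
have : 0 <= eps (star (w + c *: z) * (w + c *: z)) :> C by [].
have cr : (c * b)^* = c * b.
  rewrite divfK //; apply/CrealP; rewrite rpredM ?rpredV ?realn //.
  by rewrite rpredN rpredD // ger0_real.
have two0 : 2%:R != 0 :> C by rewrite pnatr_eq0.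
rewrite eps_expand z0 mulr0 addr0 (eps_hermitian w z) -/b -rmorphM /= cr.
rewrite divfK //.
have -> : eps (star w * w) + (- (eps (star w * w) + 1) / 2%:R +
  - (eps (star w * w) + 1) / 2%:R) = -1 :> C by field.
by rewrite oppr_ge0 ler10.
Qed.

(* Gram-Schmidt; only the reproducing formula is needed, not orthogonality. *)
Lemma parseval_frame (X : seq A) : (forall x, x \in <<X>>%VS -> N x) ->
  exists2 F : seq A, (forall f, f \in F -> f \in <<X>>%VS) &
    forall z, z \in <<X>>%VS ->
      z = \sum_(f <- F) (eps (star f * z) : C) *: f.
Proof.
elim: X => [|x X IH] NX.
  by exists [::] => // z; rewrite span_nil memv0 big_nil => /eqP.
have sXx : (<<X>> <= <<x :: X>>)%VS by rewrite span_cons addvSr.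
have [z /(subvP sXx)/NX //|F FX FE] := IH.
pose y := x - \sum_(f <- F) (eps (star f * x) : C) *: f.
have sumX : \sum_(f <- F) (eps (star f * x) : C) *: f \in <<X>>%VS.
  by rewrite big_seq; apply: memv_suml => f fF; rewrite memvZ ?FX.
have yx : y \in <<x :: X>>%VS.
  by rewrite memvB ?(subvP sXx _ sumX) // memv_span ?mem_head.
(* The residual y is orthogonal to the old span although F need not be orthogonal: expanding z by
   the reproducing formula turns both terms of eps(z^* y) into the same sum. *)
have y_orth z : z \in <<X>>%VS -> eps (star z * y) = 0.
  move=> zX; rewrite mulrBr linearB /= mulr_sumr linear_sum /=.
  rewrite [in X in X - _](FE z zX) star_sum mulr_suml linear_sum /=.
  apply/eqP; rewrite subr_eq0; apply/eqP/eq_bigr => f _.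
  rewrite starZ -scalerAl -scalerAr !linearZ /= -eps_hermitian.
  exact: mulrC.
have [y0|y0] := eqVneq y 0.
  exists F => [f fF|z]; first by rewrite (subvP sXx) ?FX.
  rewrite span_cons => zX; apply: FE; apply: subvP zX.
  rewrite subv_add subvv andbT -memvE.
  by move/eqP: y0; rewrite subr_eq0 => /eqP ->.
pose e := sqrtC (eps (star y * y) : C).
have e2 : e * e = eps (star y * y) by rewrite -expr2 sqrtCK.
have e0 : 0 < e by rewrite sqrtC_gt0; apply: eps_gt0 (NX _ yx) y0.
have ec : e^-1^* = e^-1 by apply/CrealP; rewrite gtr0_real ?invr_gt0.
exists ((e^-1 *: y) :: F) => [f|z].
  rewrite inE => /orP[/eqP ->|/FX /(subvP sXx) //].
  by rewrite memvZ.
rewrite span_cons => /memv_addP[_ /vlineP[c ->] [w wX ->]].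
have yw : eps (star y * w) = 0 by rewrite eps_hermitian y_orth ?conjC0.
have xE : x = y + \sum_(f <- F) (eps (star f * x) : C) *: f by rewrite subrK.
have yS : eps (star y * \sum_(f <- F) (eps (star f * x) : C) *: f) = 0.
  by rewrite eps_hermitian y_orth ?conjC0.
have yz : eps (star y * (c *: x + w)) = c * (e * e) :> C.
  rewrite mulrDr linearD /= yw addr0 -scalerAr linearZ /= xE mulrDr linearD.
  by rewrite /= yS addr0 -e2.
have -> : \sum_(f <- e^-1 *: y :: F) (eps (star f * (c *: x + w)) : C) *: f =
    c *: y + \sum_(f <- F) (eps (star f * (c *: x + w)) : C) *: f.
  have eyz : eps (star (e^-1 *: y) * (c *: x + w)) = e^-1 * (c * (e * e)) :> C.
    by rewrite starZ ec -scalerAl linearZ /= yz.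
  rewrite big_cons eyz scalerA; congr (_ *: _ + _).
  by field; rewrite gt_eqF.
rewrite [in RHS](eq_bigr (fun f => c *: ((eps (star f * x) : C) *: f) +
    (eps (star f * w) : C) *: f)) => [|f _].
  by rewrite big_split -scaler_sumr /= -(FE w wX) addrA -scalerDr -xE.
by rewrite mulrDr -scalerAr linearD linearZ /= scalerDl scalerA.
Qed.

(** * Elements that are positive for the functional *)

Section PositiveElement.
Variable q : A.
Hypotheses (Nq : N q) (qs : star q = q).
Hypothesis q_pos : forall v, N v -> v != 0 -> 0 < eps (star v * (q * v)) :> C.

Lemma positive_annihilator : exists s : seq C,
  [/\ uniq s, {in s, forall a, 0 < a} &
      horner_alg q (\prod_(a <- s) ('X - a%:P)) = 0].
Proof.
have [p p0 pq] := annihilating_poly q.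
have [s sE] := closed_field_poly_normal p.
have {p p0 pq sE} : horner_alg q (\prod_(a <- s) ('X - a%:P)) = 0.
  apply: (scalerI (a := lead_coef p)); first by rewrite lead_coef_eq0.
  by rewrite scaler0 -pq [in RHS]sE linearZ /= mulr_algl.
have [n] := ubnP (size s); elim: n s => // n IH s /ltnSE sn sq.
pose v a := horner_alg q (\prod_(b <- rem a s) ('X - b%:P)).
have [/hasP[a ias /eqP va]|/hasPn v0] := boolP (has (fun a => v a == 0) s).
  apply: IH va; rewrite size_rem // prednK //.
  by case: (s) ias.
have Nv a : N (v a) by apply: mem_horner_alg.
have qv a : a \in s -> (q - a%:A) * v a = 0.
  move=> ias; rewrite -sq (perm_big _ (perm_to_rem ias)) big_cons rmorphM.
  by rewrite rmorphB /= horner_algX horner_algC.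
have s_gt0 a : a \in s -> 0 < a.
  move=> ias; have /eqP := qv a ias; rewrite mulrBl subr_eq0 mulr_algl => /eqP qva.
  have := q_pos (Nv a) (v0 a ias).
  rewrite qva -scalerAr linearZ /= pmulr_lgt0 //.
  exact: eps_gt0 (Nv a) (v0 a ias).
exists s; split=> //; apply: contraT => /uniqPn-/(_ 0)[i [j [lij ljs sij]]].
pose a := s`_i; have ias : a \in s by rewrite mem_nth // (ltn_trans lij).
have iar : a \in rem a s.
  rewrite -has_pred1 has_count count_rem ias /= eqxx subn_gt0.
  rewrite -(cat_take_drop j s) count_cat -addn1 leq_add // -has_count has_pred1.
    by rewrite /a -(nth_take _ lij) mem_nth // size_take ljs.
  by rewrite (drop_nth 0) // -sij mem_head.
have ar : a^* = a by apply/CrealP; rewrite gtr0_real ?s_gt0.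
pose u := horner_alg q (\prod_(b <- rem a (rem a s)) ('X - b%:P)).
have vE : v a = (q - a%:A) * u.
  rewrite /v (perm_big _ (perm_to_rem iar)) big_cons rmorphM.
  by rewrite rmorphB /= horner_algX horner_algC.
case/eqP: (v0 a ias); apply: (eps_faithful (Nv a)).
by rewrite {1}vE starM starB starZ star1 qs ar -mulrA qv // mulr0 linear0.
Qed.

(** Functional calculus on a finite set: since the roots in s are simple, polynomials agreeing on s
    take the same value at q. Interpolating a^-1 and [sqrtC a] on s gives the inverse and the root;
    the latter is self-adjoint because its values are real. *)
Lemma positive_sqrt :
  q \is a GRing.unit /\ exists y, [/\ N y, star y = y & y * y = q].
Proof.
have [s [su s0 sq]] := positive_annihilator.
have hornerE0 r : {in s, forall a, r.[a] = 0} -> horner_alg q r = 0.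
  move=> r0; have : \prod_(z <- s) ('X - z%:P) %| r.
    by apply: uniq_roots_dvdp; rewrite ?uniq_rootsE //; apply/allP=> a /r0/eqP.
  by case/dvdpP=> r' ->; rewrite rmorphM /= sq mulr0.
have hornerE r r' : {in s, forall a, r.[a] = r'.[a]} ->
    horner_alg q r = horner_alg q r'.
  move=> rr'; apply/eqP; rewrite -subr_eq0 -rmorphB; apply/eqP/hornerE0.
  by move=> a ias; rewrite !hornerE rr' ?subrr.
split.
  have [r rE] := poly_interpolation GRing.inv su.
  apply/unitrP; exists (horner_alg q r).
  rewrite -{2 3}(horner_algX q) -!rmorphM -(rmorph1 (horner_alg q)).
  by split; apply: hornerE => a ias;
    rewrite !hornerE rE // ?mulVf ?mulfV // gt_eqF ?s0.
have [r rE] := poly_interpolation sqrtC su.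
exists (horner_alg q r); split; first exact: mem_horner_alg.
  rewrite star_horner_alg //; apply: hornerE => a ias.
  have ar : a^* = a by apply/CrealP; rewrite gtr0_real ?s0.
  rewrite -{1}ar horner_map /= rE //.
  by apply/CrealP; rewrite ger0_real // sqrtC_ge0 ltW ?s0.
rewrite -rmorphM -[RHS](horner_algX q); apply: hornerE => a ias.
by rewrite !hornerE rE // -expr2 sqrtCK.
Qed.

End PositiveElement.
End PositiveFunctional.

(** * Tensor calculus *)

Section TensorLinear.
Variable F : fieldType.
Implicit Types U V : vectType F.

Lemma tmap_linear U V U' V' (f : U -> U') (g : V -> V') : linear (tmap f g).
Proof. exact: tlift_linear. Qed.

Lemma tflip_linear U V : linear (@tflip F U V).
Proof. exact: tlift_linear. Qed.

Lemma tassoc_linear U V W : linear (@tassoc F U V W).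
Proof. exact: tlift_linear. Qed.

Lemma tmult_linear (A : falgType F) : linear (@tmult F A).
Proof. exact: tlift_linear. Qed.

Lemma linear_sum_map (U W : lmodType F) (f : U -> W) (I : Type) (r : seq I)
    (x : I -> U) : linear f -> f (\sum_(i <- r) x i) = \sum_(i <- r) f (x i).
Proof.
move=> fl; have f0 : f 0 = 0.
  by have := fl (-1) 0 0; rewrite scaler0 addr0 scaleN1r addNr.
apply: (big_morph f) => // y z.
by have := fl 1 y z; rewrite !scale1r.
Qed.

Lemma tensDl U V (x y : U) (v : V) : (x + y) ⊗ v = x ⊗ v + y ⊗ v.
Proof. by have := tens_linear_l v 1 x y; rewrite !scale1r. Qed.

Lemma tens0l U V (v : V) : (0 : U) ⊗ v = 0.
Proof. by apply/matrixP => i j; rewrite !mxE linear0 mul0r. Qed.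

Lemma tensZl U V c (x : U) (v : V) : (c *: x) ⊗ v = c *: (x ⊗ v).
Proof. by have := tens_linear_l v c x 0; rewrite tens0l !addr0. Qed.

Lemma tensZr U V c (u : U) (v : V) : u ⊗ (c *: v) = c *: (u ⊗ v).
Proof. by apply/matrixP => i j; rewrite !mxE linearZ /= mulrCA. Qed.

Lemma tens0r U V (u : U) : u ⊗ (0 : V) = 0.
Proof. by apply/matrixP => i j; rewrite !mxE linear0 mulr0. Qed.

Lemma tens_suml U V (I : Type) (r : seq I) (f : I -> U) (v : V) :
  (\sum_(i <- r) f i) ⊗ v = \sum_(i <- r) f i ⊗ v.
Proof.
apply: (big_morph (fun u => u ⊗ v)) => [x y|]; first exact: tensDl.
exact: tens0l.
Qed.

Lemma linear_scale_map (U W : lmodType F) (f : U -> W) c x :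
  linear f -> f (c *: x) = c *: f x.
Proof.
move=> fl; have f0 : f 0 = 0.
  by have := fl (-1) 0 0; rewrite scaler0 addr0 scaleN1r addNr.
by have := fl c x 0; rewrite f0 !addr0.
Qed.

Lemma tens_ext U V (W : lmodType F) (f g : tensor U V -> W) :
  linear f -> linear g -> (forall u v, f (u ⊗ v) = g (u ⊗ v)) -> f =1 g.
Proof.
move=> fl gl fg z; elim/tens_ind: z => // a x y fx fy.
by rewrite fl gl fx fy.
Qed.

Lemma linear_comp_map (U V W : lmodType F) (f : V -> W) (g : U -> V) :
  linear f -> linear g -> linear (fun x => f (g x)).
Proof. by move=> fl gl a x y; rewrite gl fl. Qed.

Lemma tmap_tens_linear U V U' V' (f : U -> U') (g : V -> V') u v :
  linear f -> linear g -> tmap f g (u ⊗ v) = f u ⊗ g v.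
Proof.
move=> fl gl; apply: tlift_tens => [y|x] a b c; first by rewrite fl tens_linear_l.
by rewrite gl tens_linear_r.
Qed.

Lemma tlift_scale_l U V (phi : U -> F^o) u v : linear phi ->
  tlift (fun u v => (phi u : F) *: v) (u ⊗ v) = (phi u : F) *: v :> V.
Proof.
move=> phi_lin; apply: tlift_tens => [y|x] c a b.
  by rewrite phi_lin scalerDl scalerA.
by rewrite scalerDr !scalerA mulrC.
Qed.

Lemma tlift_scale_r U V (phi : V -> F^o) u v : linear phi ->
  tlift (fun u v => (phi v : F) *: u) (u ⊗ v) = (phi v : F) *: u :> U.
Proof.
move=> phi_lin; apply: tlift_tens => [y|x] c a b.
  by rewrite scalerDr !scalerA mulrC.
by rewrite phi_lin scalerDl scalerA.
Qed.

(** Expansion along a basis of the first factor only. For z = Delta(1) the resulting right legs are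
    the [Delta1_leg], which span A_t. *)
Lemma tens_basis_expand U V (z : tensor U V) :
  z = \sum_(i < \dim {:U}) (vbasis {:U})`_i ⊗
        tlift (fun u v => coord (vbasis {:U}) i u *: v) z.
Proof.
rewrite {1}[z]tens_expand /tlift; apply: eq_bigr => i _.
rewrite (bigD1 i) //= [X in _ + X]big1 ?addr0 => [|j ji].
  rewrite (linear_sum_map _ _ (tens_linear_r _)); apply: eq_bigr => j _.
  by rewrite coord_vbasis_nth eqxx scale1r tensZr.
rewrite big1 ?tens0r // => k _.
by rewrite coord_vbasis_nth eq_sym (negPf ji) scale0r scaler0.
Qed.

Lemma tens_basis_inj U V (x y : 'I_(\dim {:U}) -> V) :
  \sum_(i < \dim {:U}) (vbasis {:U})`_i ⊗ x i =
    \sum_(i < \dim {:U}) (vbasis {:U})`_i ⊗ y i -> x =1 y.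
Proof.
have coordK (w : 'I_(\dim {:U}) -> V) i :
    tlift (fun u v => coord (vbasis {:U}) i u *: v)
      (\sum_(i < \dim {:U}) (vbasis {:U})`_i ⊗ w i) = w i.
  rewrite (linear_sum_map _ _ (tlift_linear _)).
  have coord_lin : linear (coord (vbasis {:U}) i : U -> F^o) by exact: linearP.
  rewrite (bigD1 i) //= big1 ?addr0 => [|j ji];
    rewrite (tlift_scale_l _ _ coord_lin) coord_vbasis_nth.
    by rewrite eqxx scale1r.
  by rewrite eq_sym (negPf ji) scale0r.
by move=> xy i; rewrite -[LHS]coordK xy coordK.
Qed.

End TensorLinear.

Section TensorAlgebra.
Variable F : fieldType.
Implicit Types A B : falgType F.

Lemma tmulP_l A B (z : tensor A B) c (x y : tensor A B) :
  (c *: x + y : tensor A B) * z =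
    c *: (x * z : tensor A B) + (y * z : tensor A B) :> tensor A B.
Proof. exact: tmul_linear_l. Qed.

Lemma tmulP_r A B (z : tensor A B) c (x y : tensor A B) :
  z * (c *: x + y : tensor A B) =
    c *: (z * x : tensor A B) + (z * y : tensor A B) :> tensor A B.
Proof. exact: tmul_linear_r. Qed.

(** Scalars are absorbed into the right legs, so closure under sums suffices. This form of induction
    suits the antilinear [tensor_star]. *)
Lemma tens_ind_add (U V : vectType F) (P : tensor U V -> Prop) :
  (forall x y, P x -> P y -> P (x + y)) -> (forall u v, P (u ⊗ v)) ->
  forall z, P z.
Proof.
move=> PD Pt z; rewrite [z]tens_basis_expand; apply: big_ind => //.
by rewrite -(tens0l U (0 : V)).
Qed.

Lemma tmulD_l A B (x y z : tensor A B) :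
  @GRing.mul (tensor A B) (x + y) z = @GRing.add (tensor A B) (x * z) (y * z).
Proof. exact: tmulDl. Qed.

Lemma tmulD_r A B (x y z : tensor A B) :
  @GRing.mul (tensor A B) z (x + y) = @GRing.add (tensor A B) (z * x) (z * y).
Proof. exact: tmulDr. Qed.

Lemma tmap_antiM A B A' B' (f : A -> A') (g : B -> B') :
  linear f -> linear g ->
  (forall x y, f (x * y) = f y * f x) -> (forall x y, g (x * y) = g y * g x) ->
  forall x y, tmap f g (x * y) = tmap f g y * tmap f g x.
Proof.
move=> fl gl fM gM; elim/tens_ind => [c x1 x2 IH1 IH2 y|a b].
  by rewrite tmulP_l !tmap_linear tmulP_r IH1 IH2.
elim/tens_ind => [c y1 y2 IH1 IH2|a' b'].
  by rewrite tmulP_r !tmap_linear tmulP_l IH1 IH2.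
by rewrite tens_mul !tmap_tens_linear // fM gM tens_mul.
Qed.

Lemma tflipM A B : {morph @tflip F A B : x y / x * y}.
Proof.
elim/tens_ind => [c x1 x2 IH1 IH2 y|a b].
  by rewrite tmulP_l !tflip_linear tmulP_l IH1 IH2.
elim/tens_ind => [c y1 y2 IH1 IH2|a' b'].
  by rewrite tmulP_r !tflip_linear tmulP_r IH1 IH2.
by rewrite tens_mul !tflip_tens tens_mul.
Qed.

Lemma tflipK A B : cancel (@tflip F A B) (@tflip F B A).
Proof.
elim/tens_ind => [c x y IHx IHy|a b]; last by rewrite !tflip_tens.
by rewrite !tflip_linear IHx IHy.
Qed.

Lemma tassocM A B A' : {morph @tassoc F A B A' : x y / x * y}.
Proof.
elim/tens_ind => [c x1 x2 IH1 IH2 y|ab a'].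
  by rewrite tmulP_l !tassoc_linear tmulP_l IH1 IH2.
elim/tens_ind => [c y1 y2 IH1 IH2|cd c'].
  by rewrite tmulP_r !tassoc_linear tmulP_r IH1 IH2.
elim/tens_ind: ab => [c x1 x2 IH1 IH2|a b].
  by rewrite tens_linear_l tmulP_l !tassoc_linear tmulP_l IH1 IH2.
elim/tens_ind: cd => [x y1 y2 IH1 IH2|c d].
  by rewrite tens_linear_l tmulP_r !tassoc_linear tmulP_r IH1 IH2.
by rewrite !(tens_mul, tassoc_tens).
Qed.

End TensorAlgebra.

(** * The involution of a tensor square *)

Section TensorStar.
Variables (C : numClosedFieldType) (A : falgType C) (star : A -> A).
Hypothesis starD : {morph star : x y / x + y}.
Hypothesis starZ : forall c x, star (c *: x) = c^* *: star x.
Hypothesis starK : involutive star.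
Hypothesis starM : forall x y, star (x * y) = star y * star x.

(** [tstar star star] with [R[i]] replaced by a general closed field; at [R[i]] the two are
    convertible. *)
Definition tensor_star (z : tensor A A) : tensor A A :=
  tlift (fun a b => star a ⊗ star b)
    (map_mx Num.conj (z : 'M_(\dim {:A}, \dim {:A})) : tensor A A).

Lemma tensor_starD (x y : tensor A A) :
  tensor_star (x + y) = tensor_star x + tensor_star y.
Proof.
rewrite /tensor_star /tlift -big_split; apply: eq_bigr => i _ /=.
rewrite -big_split; apply: eq_bigr => j _ /=.
by rewrite !mxE rmorphD scalerDl.
Qed.

Lemma tensor_star_sum (I : finType) (x : I -> tensor A A) :
  tensor_star (\sum_i x i) = \sum_i tensor_star (x i).
Proof.
apply: (big_morph tensor_star) => [|]; first exact: tensor_starD.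
by have := tensor_starD 0 0; rewrite addr0 -[X in X = _ -> _]addr0 => /addrI/esym.
Qed.

Lemma tensor_star_tens a b : tensor_star (a ⊗ b) = star a ⊗ star b.
Proof.
rewrite /tensor_star /tlift [in RHS](coord_vbasis (memvf a)).
rewrite (star_sum starD starZ) tens_suml; apply: eq_bigr => i _.
rewrite [in RHS](coord_vbasis (memvf b)) (star_sum starD starZ).
rewrite (linear_sum_map _ _ (tens_linear_r _)); apply: eq_bigr => j _.
by rewrite !starZ tensZl tensZr !mxE rmorphM scalerA.
Qed.

Lemma tensor_starM x y : tensor_star (x * y) = tensor_star y * tensor_star x.
Proof.
elim/tens_ind_add: x => [x1 x2|a b].
  by rewrite tmulD_l !tensor_starD tmulD_r => -> ->.
elim/tens_ind_add: y => [y1 y2|c d].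
  by rewrite tmulD_r !tensor_starD tmulD_l => -> ->.
by rewrite tens_mul !tensor_star_tens !starM tens_mul.
Qed.

End TensorStar.

(** * Cartan subalgebras *)

Section Antipode.
Variables (F : fieldType) (A : falgType F).
Variables (Delta : 'Hom(A, tensor A A)) (kappa : 'End(A)).
Hypothesis DeltaM : {morph Delta : x y / x * y}.
Hypothesis coassoc : forall x,
  tassoc (tmap Delta id (Delta x)) = tmap id Delta (Delta x).
Hypothesis kappaM : forall x y, kappa (x * y) = kappa y * kappa x.
Hypothesis antipode : forall x,
  tmap (fun z => tmult (tmap kappa id z)) id (tmap Delta id (Delta x)) =
  (1 ⊗ x) * Delta 1.

Local Notation D := (Delta 1).

Lemma Delta1_mulDelta x : D * Delta x = Delta x.
Proof. by rewrite -DeltaM mul1r. Qed.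

Lemma Delta_mulDelta1 x : Delta x * D = Delta x.
Proof. by rewrite -DeltaM mulr1. Qed.

Definition antipode_mult (z : tensor A A) : A := tmult (tmap kappa id z).

Lemma antipode_mult_linear : linear antipode_mult.
Proof. by move=> c x y; rewrite /antipode_mult tmap_linear tmult_linear. Qed.

Lemma antipode_mult_tens a b : antipode_mult (a ⊗ b) = kappa a * b.
Proof.
by rewrite /antipode_mult tmap_tens_linear ?tmult_tens //; apply: linearP.
Qed.

Lemma antipode_multr z x :
  antipode_mult (z * (x ⊗ 1)) = kappa x * antipode_mult z.
Proof.
elim/tens_ind: z => [c z1 z2 IH1 IH2|a b].
  rewrite tmulP_l !antipode_mult_linear IH1 IH2.
  by rewrite mulrDr -scalerAr.
by rewrite tens_mul !antipode_mult_tens kappaM mulr1 mulrA.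
Qed.

Let Delta_linear : linear Delta. Proof. exact: linearP. Qed.
Let kappa_linear : linear kappa. Proof. exact: linearP. Qed.
Let id_linear (V : vectType F) : linear (id : V -> V). Proof. by []. Qed.

(** The source counital map, x ↦ kappa(x1) x2. *)
Let counit_map x := antipode_mult (Delta x).
Let counit_map_linear : linear counit_map.
Proof. exact: linear_comp_map antipode_mult_linear Delta_linear. Qed.

Let antipodeE x : tmap counit_map id (Delta x) = (1 ⊗ x) * D.
Proof.
rewrite -antipode; move: (Delta x) => z.
elim/tens_ind: z => [c z1 z2 IH1 IH2|a b]; first by rewrite !tmap_linear IH1 IH2.
by rewrite !tmap_tens_linear //; apply: antipode_mult_linear.
Qed.

Definition Delta1_leg (i : 'I_(\dim {:A})) : A :=
  tlift (fun u v => coord (vbasis {:A}) i u *: v) D.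

Local Notation e := (vbasis {:A}).

Lemma Delta1E : D = \sum_(i < \dim {:A}) e`_i ⊗ Delta1_leg i.
Proof. exact: tens_basis_expand. Qed.

(* Applying [id ⊗ Delta] to [kappa(x1) x2 ⊗ x3 = (1 ⊗ x) Delta(1)] at [x = 1],
   and the same identity to the first two legs of [Delta(x1) ⊗ x2]. *)
Lemma Delta_Delta1_leg i : Delta (Delta1_leg i) = D * (Delta1_leg i ⊗ 1).
Proof.
move: i; apply: tens_basis_inj.
have -> : \sum_(i < \dim {:A}) e`_i ⊗ Delta (Delta1_leg i) = tmap id Delta D.
  rewrite [in RHS]Delta1E (linear_sum_map _ _ (tmap_linear _ _)).
  apply: eq_bigr => i _.
  by rewrite tmap_tens_linear.
have -> : tmap id Delta D = tmap id Delta (tmap counit_map id D).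
  by rewrite antipodeE -tens11 mul1r.
have -> : tmap id Delta (tmap counit_map id D) =
    tmap counit_map id (tassoc (tmap Delta id D)).
  rewrite coassoc; move: D => z.
  elim/tens_ind: z => [c z1 z2 IH1 IH2|a b]; first by rewrite !tmap_linear IH1 IH2.
  by rewrite !tmap_tens_linear.
elim/tens_ind: D => [c z1 z2 IH1 IH2|u v].
  rewrite !(tmap_linear, tassoc_linear) IH1 IH2 scaler_sumr -big_split.
  by apply: eq_bigr => i _ /=; rewrite tmulP_l tens_linear_r.
rewrite tmap_tens_linear //.
transitivity (tassoc (tmap counit_map id (Delta u) ⊗ v)).
  elim/tens_ind: (Delta u) => [c z1 z2 IH1 IH2|a b].
    by rewrite tens_linear_l !(tmap_linear, tassoc_linear, tens_linear_l) IH1 IH2.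
  by rewrite tmap_tens_linear // !tassoc_tens tmap_tens_linear.
rewrite antipodeE Delta1E mulr_sumr tens_suml.
rewrite (linear_sum_map _ _ (@tassoc_linear _ _ _ _)).
apply: eq_bigr => i _.
by rewrite !tens_mul tassoc_tens mul1r mulr1.
Qed.

(** The antipode axiom turns (1 ⊗ z) Delta(1) into [counit_map] applied to the left leg of Delta(1)
    (z ⊗ 1). There Delta(u z) = Delta(u) (z ⊗ 1), so z leaves [counit_map] as a left factor
    kappa(z). *)
Lemma Delta1_mull z : Delta z = D * (z ⊗ 1) -> (1 ⊗ z) * D = (kappa z ⊗ 1) * D.
Proof.
move=> z1; rewrite -{1}antipodeE z1 -[X in _ = _ * X]mul1r tens11 -antipodeE.
elim/tens_ind: D => [c x y IHx IHy|u v].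
  by rewrite tmulP_l !tmap_linear tmulP_r IHx IHy.
rewrite tens_mul !tmap_tens_linear // tens_mul mulr1 mul1r /counit_map.
by rewrite DeltaM z1 mulrA Delta_mulDelta1 antipode_multr.
Qed.

End Antipode.

(* [is_quantum_groupoid] without the C*-norm, over an arbitrary closed field. *)
Record weak_hopf (C : numClosedFieldType) (A : falgType C) (star : A -> A)
    (Delta : 'Hom(A, tensor A A)) (kappa : 'End(A)) (eps : 'Hom(A, C^o)) :
    Prop := WeakHopf {
  wh_starD : {morph star : x y / x + y};
  wh_starZ : forall c x, star (c *: x) = c^* *: star x;
  wh_starK : involutive star;
  wh_starM : forall x y, star (x * y) = star y * star x;
  wh_DeltaM : {morph Delta : x y / x * y};
  wh_Delta_star : forall x, Delta (star x) = tensor_star star (Delta x);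
  wh_coassoc : forall x,
    tassoc (tmap Delta id (Delta x)) = tmap id Delta (Delta x);
  wh_kappa_star : forall x, kappa (star (kappa (star x))) = x;
  wh_kappaM : forall x y, kappa (x * y) = kappa y * kappa x;
  wh_kappa_Delta : forall x,
    tmap kappa kappa (Delta x) = tflip (Delta (kappa x));
  wh_antipode : forall x,
    tmap (fun z => tmult (tmap kappa id z)) id (tmap Delta id (Delta x)) =
    (1 ⊗ x) * Delta 1;
  wh_eps_ge0 : forall x, 0 <= eps (star x * x) :> C;
  wh_counit_l : forall x, tlift (fun a b => (eps a : C) *: b) (Delta x) = x;
  wh_counit_r : forall x, tlift (fun a b => (eps b : C) *: a) (Delta x) = x;
  wh_eps_mul : forall x y,
    tlift (fun a b => eps a * eps b : C^o) ((x ⊗ 1) * Delta 1 * (1 ⊗ y)) =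
    eps (x * y) }.

(** [target] and, below, [source] over a general field, convertible to the originals at [R[i]]. *)
Definition in_target (F : fieldType) (A : falgType F)
    (Delta : 'Hom(A, tensor A A)) (x : A) : Prop :=
  Delta x = Delta 1 * (x ⊗ 1) /\ Delta 1 * (x ⊗ 1) = (x ⊗ 1) * Delta 1.

Definition in_source (F : fieldType) (A : falgType F)
    (Delta : 'Hom(A, tensor A A)) (x : A) : Prop :=
  Delta x = Delta 1 * (1 ⊗ x) /\ Delta 1 * (1 ⊗ x) = (1 ⊗ x) * Delta 1.

(** * The target algebra, the legs of Delta(1) and the counit *)

Section Groupoid.
Variables (C : numClosedFieldType) (A : falgType C) (star : A -> A).
Variables (Delta : 'Hom(A, tensor A A)) (kappa : 'End(A)) (eps : 'Hom(A, C^o)).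
Hypothesis hG : weak_hopf star Delta kappa eps.

Local Notation D := (Delta 1).
Local Notation e := (vbasis {:A}).
Local Notation leg := (Delta1_leg Delta).

Let starD := wh_starD hG.
Let starZ := wh_starZ hG.
Let starK := wh_starK hG.
Let starM := wh_starM hG.
Let DeltaM := wh_DeltaM hG.
Let coassoc := wh_coassoc hG.
Let kappaM := wh_kappaM hG.
Let antipode := wh_antipode hG.

Let Delta_linear : linear Delta. Proof. exact: linearP. Qed.
Let kappa_linear : linear kappa. Proof. exact: linearP. Qed.

Let eps_linear : linear eps. Proof. exact: linearP. Qed.

Let starT1 : star 1 = 1. Proof. exact: star1 starK starM. Qed.

Let DD : D * D = D. Proof. by rewrite -DeltaM mulr1. Qed.

Lemma qg_Delta_inj : injective Delta.
Proof. by move=> x y xy; rewrite -[x](wh_counit_l hG) xy (wh_counit_l hG). Qed.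

Lemma qg_starD : tensor_star star D = D.
Proof. by rewrite -(wh_Delta_star hG) starT1. Qed.

Lemma qg_kappa_inj : injective kappa.
Proof.
move=> x y kxy; apply: (can_inj starK).
rewrite -[star x](wh_kappa_star hG) -[star y](wh_kappa_star hG).
by rewrite !starK kxy.
Qed.

(** The inverse of the antipode, made explicit by the axiom that kappa composed with the involution
    has square i. *)
Definition kappa_inv x := star (kappa (star x)).

Lemma kappa_invK : cancel kappa_inv kappa.
Proof. exact: wh_kappa_star hG. Qed.

Lemma kappa_inv_lfun x : (kappa^-1)%VF x = kappa_inv x.
Proof.
have k0 : lker kappa == 0%VS by apply/lker0P/qg_kappa_inj.
by rewrite -{1}[x]kappa_invK lker0_lfunK.
Qed.

Lemma kappa_inv_linear : linear kappa_inv.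
Proof. by move=> c x y; rewrite -!kappa_inv_lfun linearP. Qed.

Lemma kappa_invM x y : kappa_inv (x * y) = kappa_inv y * kappa_inv x.
Proof. by rewrite /kappa_inv starM kappaM starM. Qed.

Lemma qg_kappa1 : kappa 1 = 1.
Proof.
by rewrite -[LHS]mulr1 -{2}[1]kappa_invK -kappaM mulr1 kappa_invK.
Qed.

(** Delta(1) is self-adjoint, so each leg is a combination of adjoints of legs. Adjoining Delta(leg)
    = Delta(1) (leg ⊗ 1) then yields the same equation with the factors in the other order. *)
Lemma Delta1_leg_star j : leg j =
  \sum_(i < \dim {:A}) coord e j (star e`_i) *: star (leg i).
Proof.
rewrite {1}/Delta1_leg -[X in tlift _ X]qg_starD Delta1E.
have -> : tensor_star star (\sum_(i < \dim {:A}) e`_i ⊗ leg i) =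
    \sum_(i < \dim {:A}) star e`_i ⊗ star (leg i).
  rewrite tensor_star_sum; apply: eq_bigr => i _.
  exact: tensor_star_tens.
rewrite (linear_sum_map _ _ (tlift_linear _)); apply: eq_bigr => i _.
have coord_lin : linear (coord e j : A -> C^o) by exact: linearP.
by rewrite (tlift_scale_l _ _ coord_lin).
Qed.

Lemma target_Delta1_leg i : in_target Delta (leg i).
Proof.
have leg_star j : Delta (star (leg j)) = (star (leg j) ⊗ 1) * D.
  rewrite (wh_Delta_star hG) (Delta_Delta1_leg coassoc antipode).
  rewrite (tensor_starM starD starZ starM) (tensor_star_tens starD starZ) starT1.
  by rewrite qg_starD.
have legr : Delta (leg i) = (leg i ⊗ 1) * D.
  rewrite Delta1_leg_star (linear_sum_map _ _ Delta_linear) tens_suml mulr_suml.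
  by apply: eq_bigr => j _; rewrite linearZ /= leg_star tensZl tscaleAl.
by split; rewrite -?(Delta_Delta1_leg coassoc antipode).
Qed.

Lemma target1 : in_target Delta 1.
Proof. by rewrite /in_target -tens11 mulr1 mul1r. Qed.

Lemma targetP c x y :
  in_target Delta x -> in_target Delta y -> in_target Delta (c *: x + y).
Proof.
move=> [x1 x2] [y1 y2]; rewrite /in_target Delta_linear x1 y1 tens_linear_l.
by rewrite tmulP_l tmulP_r x2 y2.
Qed.

Lemma target0 : in_target Delta 0.
Proof. by have := targetP (-1) target1 target1; rewrite scaleN1r addNr. Qed.

Lemma targetZ c x : in_target Delta x -> in_target Delta (c *: x).
Proof. by move=> xT; rewrite -[_ *: _]addr0; apply/targetP/target0. Qed.

Lemma tens1M (x y : A) : (x * y) ⊗ (1 : A) = (x ⊗ 1) * (y ⊗ 1).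
Proof. by rewrite tens_mul mulr1. Qed.

Let target_DxD x : in_target Delta x -> D * (x ⊗ 1) * D = D * (x ⊗ 1).
Proof. by case=> _ ->; rewrite -mulrA DD. Qed.

Let source_DxD x : in_source Delta x -> D * (1 ⊗ x) * D = D * (1 ⊗ x).
Proof. by case=> _ ->; rewrite -mulrA DD. Qed.

Lemma targetM x y :
  in_target Delta x -> in_target Delta y -> in_target Delta (x * y).
Proof.
move=> xT yT; have [[x1 x2] [y1 y2]] := (xT, yT).
rewrite /in_target DeltaM x1 y1 tens1M; split.
  by rewrite mulrA target_DxD // -mulrA.
by rewrite mulrA x2 -[LHS]mulrA y2 mulrA.
Qed.

Lemma target_star x : in_target Delta x -> in_target Delta (star x).
Proof.
move=> [x1 x2]; rewrite /in_target (wh_Delta_star hG) x1.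
have -> : (star x ⊗ 1) * D = tensor_star star (D * (x ⊗ 1)).
  rewrite (tensor_starM starD starZ starM) (tensor_star_tens starD starZ).
  by rewrite starT1 qg_starD.
have -> : D * (star x ⊗ 1) = tensor_star star ((x ⊗ 1) * D).
  rewrite (tensor_starM starD starZ starM) (tensor_star_tens starD starZ).
  by rewrite starT1 qg_starD.
by rewrite x2.
Qed.

(** An antimultiplicative map that carries Delta(x) to Delta(kappa x), fixes Delta(1) and swaps the
    legs, hence exchanges the equations of A_t and A_s. *)
Let flip_kappa z := tflip (tmap kappa kappa z).

Let flip_kappaM y z : flip_kappa (y * z) = flip_kappa z * flip_kappa y.
Proof. by rewrite /flip_kappa tmap_antiM // tflipM. Qed.

Let flip_kappa_tens x y : flip_kappa (x ⊗ y) = kappa y ⊗ kappa x.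
Proof. by rewrite /flip_kappa tmap_tens_linear // tflip_tens. Qed.

Let flip_kappa_Delta x : flip_kappa (Delta x) = Delta (kappa x).
Proof. by rewrite /flip_kappa (wh_kappa_Delta hG) tflipK. Qed.

Let flip_kappaD : flip_kappa D = D.
Proof. by rewrite flip_kappa_Delta qg_kappa1. Qed.

Lemma source_kappa x : in_target Delta x -> in_source Delta (kappa x).
Proof.
move=> [x1 x2]; rewrite /in_source -flip_kappa_Delta x1.
have -> : D * (1 ⊗ kappa x) = flip_kappa ((x ⊗ 1) * D).
  by rewrite flip_kappaM flip_kappaD flip_kappa_tens qg_kappa1.
have -> : (1 ⊗ kappa x) * D = flip_kappa (D * (x ⊗ 1)).
  by rewrite flip_kappaM flip_kappaD flip_kappa_tens qg_kappa1.
by rewrite x2.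
Qed.

(** Delta is injective, and in Delta(x y) the elements x and y sit in different legs to the right of
    a single Delta(1). *)
Lemma target_source_comm x y :
  in_target Delta x -> in_source Delta y -> x * y = y * x.
Proof.
move=> xT yS; have [[x1 _] [y1 _]] := (xT, yS).
apply: qg_Delta_inj; rewrite !DeltaM x1 y1 !mulrA target_DxD // source_DxD //.
by rewrite -!mulrA !tens_mul !mulr1 !mul1r.
Qed.

Lemma target_mull z : in_target Delta z -> (1 ⊗ z) * D = (kappa z ⊗ 1) * D.
Proof. by case=> z1 _; apply: Delta1_mull. Qed.

Lemma target_mulr z : in_target Delta z -> D * (1 ⊗ z) = D * (kappa_inv z ⊗ 1).
Proof.
move=> /target_star/target_mull/(congr1 (tensor_star star)).
rewrite !(tensor_starM starD starZ starM) !(tensor_star_tens starD starZ).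
by rewrite !starT1 starK qg_starD.
Qed.

(** Apply eps ⊗ i to Delta(z) = Delta(1) (z ⊗ 1). *)
Lemma target_expand z : Delta z = D * (z ⊗ 1) ->
  z = \sum_(i < \dim {:A}) (eps (e`_i * z) : C) *: leg i.
Proof.
move=> z1; rewrite -[LHS](wh_counit_l hG) z1 Delta1E mulr_suml.
rewrite (linear_sum_map _ _ (tlift_linear _)).
by apply: eq_bigr => i _; rewrite tens_mul mulr1 tlift_scale_l.
Qed.

(** The mirror image of [target_expand]: apply i ⊗ eps to Delta(1) (1 ⊗ z) = Delta(1) (kappa^-1(z) ⊗
    1). *)
Lemma kappa_inv_expand z : in_target Delta z ->
  kappa_inv z = \sum_(i < \dim {:A}) (eps (leg i * z) : C) *: e`_i.
Proof.
pose ctr := tlift (fun a b : A => (eps b : C) *: a).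
have ctr_tens a b : ctr (a ⊗ b) = (eps b : C) *: a.
  exact: tlift_scale_r.
have ctr_linear : linear ctr by exact: tlift_linear.
move=> zt; transitivity (ctr (D * (kappa_inv z ⊗ 1))).
  have -> x y : ctr (y * (x ⊗ 1)) = ctr y * x.
    elim/tens_ind: y => [c y1 y2 IH1 IH2|a b].
      by rewrite tmulP_l !ctr_linear mulrDl -scalerAl IH1 IH2.
    by rewrite tens_mul mulr1 !ctr_tens scalerAl.
  by rewrite /ctr (wh_counit_r hG) mul1r.
rewrite -target_mulr // Delta1E mulr_suml (linear_sum_map _ _ ctr_linear).
apply: eq_bigr => i _.
by rewrite tens_mul mulr1 ctr_tens.
Qed.

Lemma target_sum (I : eqType) (r : seq I) (x : I -> A) :
  (forall i, i \in r -> in_target Delta (x i)) ->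
  in_target Delta (\sum_(i <- r) x i).
Proof.
move=> xT; rewrite big_seq; apply: big_ind => //; first exact: target0.
by move=> y z yT zT; rewrite -[y]scale1r; apply: targetP.
Qed.

(** [flip_kappa] gives only the equation Delta(kappa x) = Delta(1) (kappa x ⊗ 1). The commutation
    with Delta(1) follows by expanding kappa(x) over the legs, which already lie in A_t. *)
Lemma target_kappa_source x : Delta x = (1 ⊗ x) * D -> in_target Delta (kappa x).
Proof.
move=> x1; have kx1 : Delta (kappa x) = D * (kappa x ⊗ 1).
  by rewrite -flip_kappa_Delta x1 flip_kappaM flip_kappaD flip_kappa_tens qg_kappa1.
rewrite (target_expand kx1); apply: target_sum => i _.
exact/targetZ/target_Delta1_leg.
Qed.

Lemma eps_target_faithful z : in_target Delta z -> eps (star z * z) = 0 -> z = 0.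
Proof.
move=> zt z0; rewrite (target_expand (proj1 zt)) big1 // => i _.
by rewrite (eps_cauchy_schwarz0 starD starZ starK (wh_eps_ge0 hG) e`_i z0) scale0r.
Qed.

Lemma target_frame : exists2 F : seq A, (forall f, f \in F -> in_target Delta f) &
  forall z, in_target Delta z -> z = \sum_(f <- F) (eps (star f * z) : C) *: f.
Proof.
pose X := [tuple leg i | i < \dim {:A}].
have XT x : x \in <<X>>%VS -> in_target Delta x.
  move=> /coord_span ->; apply: target_sum => i _; apply: targetZ.
  by rewrite -tnth_nth tnth_mktuple; apply: target_Delta1_leg.
have [F FX FE] := parseval_frame starD starZ (wh_eps_ge0 hG)
  eps_target_faithful XT.
exists F => [f /FX/XT //|z zt]; apply: FE.
rewrite (target_expand (proj1 zt)); apply: memv_suml => i _; apply/memvZ/memv_span.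
by apply/tnthP; exists i; rewrite tnth_mktuple.
Qed.

End Groupoid.

(** * The canonical element *)

Section CanonicalElement.
Variables (C : numClosedFieldType) (A : falgType C) (star : A -> A).
Variables (Delta : 'Hom(A, tensor A A)) (kappa : 'End(A)) (eps : 'Hom(A, C^o)).
Hypothesis hG : weak_hopf star Delta kappa eps.

Local Notation D := (Delta 1).
Local Notation e := (vbasis {:A}).
Local Notation leg := (Delta1_leg Delta).
Local Notation kinv := (kappa_inv star kappa).

Let starD := wh_starD hG.
Let starZ := wh_starZ hG.
Let starK := wh_starK hG.
Let starM := wh_starM hG.
Let DeltaM := wh_DeltaM hG.
Let kappaM := wh_kappaM hG.
Let kappa_linear : linear kappa. Proof. exact: linearP. Qed.
Let kinv_linear : linear kinv. Proof. exact: kappa_inv_linear hG. Qed.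
Let id_linear (V : vectType C) : linear (id : V -> V). Proof. by []. Qed.

Variable F : seq A.
Hypothesis F_target : forall f, f \in F -> in_target Delta f.
Hypothesis F_frame : forall z, in_target Delta z ->
  z = \sum_(f <- F) (eps (star f * z) : C) *: f.

Lemma frame_star_expand z : in_target Delta z ->
  z = \sum_(f <- F) (eps (z * f) : C) *: star f.
Proof.
move=> zT; rewrite -[LHS]starK [star z](F_frame (target_star hG zT)).
rewrite (star_sum starD starZ); apply: eq_bigr => f _.
by rewrite starZ -starM (eps_star starD starZ starK starM (wh_eps_ge0 hG)) conjCK.
Qed.

(** Expand each right leg over the f^* and collect the basis vectors: the coefficient of f^* is the
    expansion of kappa^-1(f) in [kappa_inv_expand]. *)
Lemma Delta1_frame : D = \sum_(f <- F) kinv f ⊗ star f.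
Proof.
rewrite [LHS]Delta1E.
transitivity (\sum_(i < \dim {:A}) \sum_(f <- F)
    (((eps (leg i * f) : C) *: e`_i) ⊗ star f)).
  apply: eq_bigr => i _.
  rewrite {1}[leg i](frame_star_expand (target_Delta1_leg hG i)).
  rewrite (linear_sum_map _ _ (tens_linear_r _)); apply: eq_bigr => f _.
  by rewrite tensZr tensZl.
rewrite exchange_big /=; apply: eq_big_seq => f fF; rewrite -tens_suml.
by rewrite -(kappa_inv_expand hG (F_target fF)).
Qed.

(** The Casimir property of \sum f ⊗ f^* for inner multiplication: kappa ⊗ i applied to
    [target_mulr]. *)
Lemma frame_swap_tens z : in_target Delta z ->
  \sum_(f <- F) (z * f) ⊗ star f = \sum_(f <- F) f ⊗ (star f * z).
Proof.
move=> zT; have := congr1 (tmap kappa id) (target_mulr hG zT).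
rewrite Delta1_frame !mulr_suml !(linear_sum_map _ _ (tmap_linear _ _)) => E.
symmetry; transitivity (\sum_(f <- F)
    tmap kappa id (kinv f ⊗ star f * (1 ⊗ z))).
  apply: eq_bigr => f _.
  by rewrite tens_mul mulr1 tmap_tens_linear // (kappa_invK hG).
rewrite E; apply: eq_bigr => f _.
by rewrite tens_mul mulr1 tmap_tens_linear // kappaM !(kappa_invK hG).
Qed.

(** The same from [target_mull], for the outer sides. Here kappa is applied to kappa(z) kappa^-1(f),
    which is the source of kappa^2. *)
Lemma frame_shift_tens z : in_target Delta z ->
  \sum_(f <- F) (f * kappa (kappa z)) ⊗ star f =
  \sum_(f <- F) f ⊗ (z * star f).
Proof.
move=> zT; have := congr1 (tmap kappa id) (target_mull hG zT).
rewrite Delta1_frame !mulr_sumr !(linear_sum_map _ _ (tmap_linear _ _)) => E.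
symmetry; transitivity (\sum_(f <- F)
    tmap kappa id ((1 ⊗ z) * (kinv f ⊗ star f))).
  apply: eq_bigr => f _.
  by rewrite tens_mul mul1r tmap_tens_linear // (kappa_invK hG).
rewrite E; apply: eq_bigr => f _.
by rewrite tens_mul mul1r tmap_tens_linear // kappaM !(kappa_invK hG).
Qed.

Lemma frame_swap (W : lmodType C) (B : A -> A -> W) z :
  (forall y, linear (fun x => B x y)) -> (forall x, linear (B x)) ->
  in_target Delta z ->
  \sum_(f <- F) B (z * f) (star f) = \sum_(f <- F) B f (star f * z).
Proof.
move=> Bl Br zT; have := congr1 (tlift B) (frame_swap_tens zT).
rewrite !(linear_sum_map _ _ (tlift_linear _)) => E.
transitivity (\sum_(f <- F) tlift B ((z * f) ⊗ star f)).
  by apply: eq_bigr => f _; rewrite tlift_tens.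
by rewrite E; apply: eq_bigr => f _; rewrite tlift_tens.
Qed.

Definition canonical : A := \sum_(f <- F) star f * f.
Local Notation q := canonical.

Lemma canonical_star : star q = q.
Proof.
rewrite (star_sum starD starZ); apply: eq_bigr => f _.
by rewrite starM starK.
Qed.

Lemma target_canonical : in_target Delta q.
Proof.
by apply: target_sum => f /F_target fT; apply/(targetM hG)/fT/(target_star hG).
Qed.

(** Opposite multiplication applied to [frame_shift_tens]; it sends \sum f ⊗ f^* to q. *)
Lemma canonical_shift z : in_target Delta z -> z * q = q * kappa (kappa z).
Proof.
move=> zT; have := congr1 (fun t => tmult (tflip t)) (frame_shift_tens zT).
rewrite !(linear_sum_map _ _ (@tflip_linear _ _ _)).
rewrite !(linear_sum_map _ _ (@tmult_linear _ _)) => E.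
rewrite mulr_sumr mulr_suml; transitivity (\sum_(f <- F)
    tmult (tflip (f ⊗ (z * star f)))).
  by apply: eq_bigr => f _; rewrite tflip_tens tmult_tens mulrA.
rewrite -E; apply: eq_bigr => f _.
by rewrite tflip_tens tmult_tens mulrA.
Qed.

(** eps(v^* q v) is the sum of the nonnegative terms eps((f v)^* (f v)). If it vanishes, every f v
    is 0, and so is v, because 1 is a combination of the f. *)
Lemma canonical_pos v : in_target Delta v -> v != 0 ->
  0 < eps (star v * (q * v)) :> C.
Proof.
move=> vT; have -> : eps (star v * (q * v)) =
    \sum_(f <- F) (eps (star (f * v) * (f * v)) : C) :> C.
  rewrite mulr_suml mulr_sumr linear_sum; apply: eq_bigr => f _ /=.
  by rewrite starM !mulrA.
have ge0 f : 0 <= eps (star (f * v) * (f * v)) :> C by apply: wh_eps_ge0 hG _.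
move=> v0; rewrite lt_def sumr_ge0 => [|f _]; last exact: ge0.
rewrite andbT; apply: contra v0.
rewrite psumr_eq0 => [/allP fv0|f _]; last exact: ge0.
rewrite -[v]mul1r [1](F_frame (target1 Delta)) mulr_suml big_seq big1 // => f fF.
have fvT : in_target Delta (f * v) by apply: (targetM hG) vT; apply: F_target.
rewrite -scalerAl (eps_target_faithful hG fvT) ?scaler0 //.
exact/eqP/fv0.
Qed.

Lemma canonical_sqrt : q \is a GRing.unit /\
  exists y, [/\ in_target Delta y, star y = y & y * y = q].
Proof.
apply: (positive_sqrt starD starZ starK starM (wh_eps_ge0 hG)
  (target1 Delta) (@targetP _ _ Delta) (targetM hG) (eps_target_faithful hG)
  target_canonical canonical_star).
exact: canonical_pos.
Qed.

Let qU : q \is a GRing.unit. Proof. by case: canonical_sqrt. Qed.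

Lemma targetV z : z \is a GRing.unit -> in_target Delta z -> in_target Delta z^-1.
Proof.
move=> zU [z1 z2].
have DzDl := Delta1_mulDelta DeltaM; have DzDr := Delta_mulDelta1 DeltaM.
have tensV : (z ⊗ 1) * (z^-1 ⊗ 1) = 1 :> tensor A A.
  by rewrite tens_mul mulrV // mulr1.
have tensV' : (z^-1 ⊗ 1) * (z ⊗ 1) = 1 :> tensor A A.
  by rewrite tens_mul mulVr // mulr1.
have e1 : Delta z^-1 = (z^-1 ⊗ 1) * D.
  rewrite -{2}(mulrV zU) DeltaM z1 z2 -[X in _ * X]mulrA DzDl mulrA tensV'.
  by rewrite mul1r.
have e2 : Delta z^-1 = D * (z^-1 ⊗ 1).
  by rewrite -{1}(mulVr zU) DeltaM z1 mulrA DzDr -mulrA tensV mulr1.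
by split; rewrite -?e1 -?e2.
Qed.

Let qVT : in_target Delta q^-1.
Proof. exact: targetV target_canonical. Qed.

Lemma kappa2_target z : in_target Delta z -> kappa (kappa z) = q^-1 * z * q.
Proof. by move=> zT; rewrite -mulrA canonical_shift // mulKr. Qed.

Lemma kappa2_canonical : kappa (kappa q) = q.
Proof. by rewrite kappa2_target ?mulVr ?mul1r //; apply: target_canonical. Qed.

Let qqV : q * q^-1 = 1. Proof. exact: mulrV. Qed.

(* With [c = \sum f q^-1 f^*], which is central in the target algebra, the sum
   [\sum_(f, g) g^* f^* f q^-1 g] equals both [q] and [c q]. *)
Lemma canonical_expect : \sum_(f <- F) f * q^-1 * star f = 1.
Proof.
pose c := \sum_(f <- F) f * q^-1 * star f.
have cC z : in_target Delta z -> z * c = c * z.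
  move=> zT; rewrite mulr_sumr mulr_suml.
  under eq_bigr do rewrite !mulrA; under [in RHS]eq_bigr do rewrite -mulrA.
  apply: (frame_swap (B := fun x y => x * q^-1 * y)) => // [y|x] a u v.
    by rewrite !mulrDl -!scalerAl.
  by rewrite mulrDr -scalerAr.
pose S := \sum_(f <- F) \sum_(g <- F) star g * star f * (f * q^-1 * g).
have S1 : S = q.
  rewrite /S exchange_big; apply: eq_bigr => g _.
  transitivity (star g * (q * q^-1) * g); last by rewrite qqV mulr1.
  rewrite [X in star g * (X * _) * g]/canonical.
  rewrite mulr_suml mulr_sumr mulr_suml; apply: eq_bigr => f _.
  by rewrite !mulrA.
have S2 : S = c * q.
  have fqT f : f \in F -> in_target Delta (f * q^-1).
    by move=> fF; apply: (targetM hG) qVT; apply: F_target.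
  transitivity (\sum_(f <- F) \sum_(g <- F) (star g * (f * q^-1)) * star f * g).
    apply: eq_big_seq => f fF.
    apply: (frame_swap (B := fun x y => y * star f * x)) (fqT f fF).
      by move=> y a u v; rewrite mulrDr -scalerAr.
    by move=> x a u v; rewrite !mulrDl -!scalerAl.
  rewrite exchange_big /= mulr_sumr; apply: eq_big_seq => g gF.
  rewrite mulrA -cC; last exact/(target_star hG)/F_target.
  rewrite mulr_sumr mulr_suml; apply: eq_bigr => f _.
  by rewrite !mulrA.
by rewrite -/c -[c](mulrK qU) -S2 S1 mulrV.
Qed.

(** In frames the product is \sum kappa^-1(g f) ⊗ f^* q^-1 g^* over f and g. Moving g into the right
    leg produces \sum_g g q^-1 g^* there, which is 1. *)
Lemma Delta1_canonical : D * (1 ⊗ q^-1) * D = D.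
Proof.
rewrite {2}Delta1_frame mulr_sumr.
transitivity (\sum_(g <- F) \sum_(f <- F) kinv (g * f) ⊗ (star f * q^-1 * star g)).
  apply: eq_bigr => g _; rewrite Delta1_frame -mulrA mulr_suml; apply: eq_bigr => f _.
  by rewrite !tens_mul mul1r mulrA (kappa_invM hG).
transitivity (\sum_(g <- F) \sum_(f <- F) kinv f ⊗ (star f * (g * q^-1 * star g))).
  apply: eq_big_seq => g gF.
  transitivity (\sum_(f <- F) kinv f ⊗ (star f * g * q^-1 * star g)).
    apply: (frame_swap (B := fun x y => kinv x ⊗ (y * q^-1 * star g))).
    - by move=> y a u v; rewrite kinv_linear tens_linear_l.
    - by move=> x a u v; rewrite !mulrDl -!scalerAl tens_linear_r.
    exact: F_target.
  by apply: eq_bigr => f _; rewrite !mulrA.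
rewrite exchange_big [RHS]Delta1_frame; apply: eq_bigr => f _ /=.
rewrite -(linear_sum_map _ _ (tens_linear_r _)) -mulr_sumr canonical_expect.
by rewrite mulr1.
Qed.

(* Applied below to [a k ⊗ b k = 1/n_g e_ij ⊗ e_ji], [k = (g, (i, j))]. *)
Lemma frame_casimir (K : finType) (a b : K -> A) :
  (forall k, in_target Delta (b k)) ->
  (forall z, in_target Delta z ->
     \sum_k (a k * z) ⊗ b k = \sum_k a k ⊗ (z * b k)) ->
  \sum_k a k * b k = 1 ->
  D = \sum_k kinv (a k * q) ⊗ b k.
Proof.
move=> bT ab ab1.
(* Write q as \sum f^* f, move f^* across the (a, b) tensor by [ab], then move b_k across the frame
   by [frame_swap_tens]. This brings a_k and b_k together in the left leg, where they sum to 1. *)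
have E : \sum_k (a k * q) ⊗ b k = \sum_(f <- F) f ⊗ star f.
  transitivity (\sum_(f <- F) (\sum_k (a k * star f) ⊗ b k) * (f ⊗ 1)).
    under [RHS]eq_bigr do rewrite mulr_suml.
    rewrite exchange_big; apply: eq_bigr => k _ /=.
    rewrite mulr_sumr tens_suml; apply: eq_bigr => f _.
    by rewrite tens_mul mulr1 mulrA.
  transitivity (\sum_k (a k ⊗ 1) * \sum_(f <- F) f ⊗ (star f * b k)).
    under [RHS]eq_bigr do rewrite mulr_sumr.
    rewrite [RHS]exchange_big; apply: eq_big_seq => f fF /=.
    rewrite ab ?mulr_suml; last exact/(target_star hG)/F_target.
    by apply: eq_bigr => k _; rewrite !tens_mul mulr1 mul1r.
  under eq_bigr => k _ do rewrite -frame_swap_tens // mulr_sumr.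
  rewrite exchange_big; apply: eq_bigr => f _ /=.
  rewrite -[X in _ = X ⊗ _]mul1r -[X in _ = (X * _) ⊗ _]ab1 mulr_suml tens_suml.
  by apply: eq_bigr => k _; rewrite tens_mul mul1r mulrA.
rewrite Delta1_frame.
transitivity (tmap kinv id (\sum_(f <- F) f ⊗ star f)).
  rewrite (linear_sum_map _ _ (tmap_linear _ _)); apply: eq_bigr => f _.
  by rewrite tmap_tens_linear.
rewrite -E (linear_sum_map _ _ (tmap_linear _ _)); apply: eq_bigr => k _.
by rewrite tmap_tens_linear.
Qed.

End CanonicalElement.

(** * The deformation by an admissible element *)

Section Deformation.
Variables (C : numClosedFieldType) (A : falgType C) (star : A -> A).
Variables (Delta : 'Hom(A, tensor A A)) (kappa : 'End(A)) (eps : 'Hom(A, C^o)).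
Hypothesis hG : weak_hopf star Delta kappa eps.

Local Notation D := (Delta 1).

Let starD := wh_starD hG.
Let starZ := wh_starZ hG.
Let starK := wh_starK hG.
Let starM := wh_starM hG.
Let DeltaM := wh_DeltaM hG.
Let kappaM := wh_kappaM hG.
Let Delta_linear : linear Delta. Proof. exact: linearP. Qed.
Let kappa_linear : linear kappa. Proof. exact: linearP. Qed.
Let eps_linear : linear eps. Proof. exact: linearP. Qed.
Let id_linear (V : vectType C) : linear (id : V -> V). Proof. by []. Qed.
Let DDl := Delta1_mulDelta DeltaM.
Let DDr := Delta_mulDelta1 DeltaM.

Variables k y : A.
Hypotheses (kT : in_target Delta k) (kU : k \is a GRing.unit).
Hypotheses (ys : star y = y) (yy : y * y = k).
(** Three facts known for the canonical element. They serve, in order, to control the square of the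
    deformed antipode, to make Delta_k multiplicative, and to absorb the k^-1 that appears inside
    the deformed antipode axiom. *)
Hypothesis kappa2_k : forall z, in_target Delta z -> kappa (kappa z) = k^-1 * z * k.
Hypothesis D_kV_D : D * (1 ⊗ k^-1) * D = D.
Hypothesis expect_kV : tlift (fun a b => kappa a * k^-1 * b) D = 1.

Let ks : star k = k. Proof. by rewrite -yy starM ys. Qed.
Let kVs : star k^-1 = k^-1. Proof. by rewrite (starV starK starM kU) ks. Qed.
Let kVT : in_target Delta k^-1. Proof. exact: targetV hG _ kU kT. Qed.

(* [deform_star], [deform_Delta], [deform_kappa] and [deform_eps] over [C]. *)
Definition dstar (a : A) : A := k * star a * k^-1.
Definition dDelta : 'Hom(A, tensor A A) := (amulr (1 ⊗ k^-1)%R \o Delta)%VF.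
Definition dkappa : 'End(A) := (amulr (k^-1)%R \o amull k \o kappa)%VF.
Definition deps : 'Hom(A, C^o) := (eps \o amulr k)%VF.

Lemma dDeltaE a : dDelta a = Delta a * (1 ⊗ k^-1).
Proof. by rewrite comp_lfunE lfunE. Qed.

Lemma dkappaE a : dkappa a = k * kappa a * k^-1.
Proof. by rewrite !comp_lfunE !lfunE. Qed.

Lemma depsE a : deps a = eps (a * k).
Proof. by rewrite comp_lfunE lfunE. Qed.

Let dkappa_linear : linear dkappa. Proof. exact: linearP. Qed.
Let deps_linear : linear deps. Proof. exact: linearP. Qed.
Let dDelta_linear : linear dDelta. Proof. exact: linearP. Qed.

Let dstarD : {morph dstar : a b / a + b}.
Proof. by move=> a b; rewrite /dstar starD mulrDr mulrDl. Qed.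

Let dstarZ c a : dstar (c *: a) = c^* *: dstar a.
Proof. by rewrite /dstar starZ -scalerAr -scalerAl. Qed.

Let dstarK : involutive dstar.
Proof.
by move=> a; rewrite /dstar !starM starK ks kVs !mulrA mulrV // mul1r mulrK.
Qed.

Let dstarM a b : dstar (a * b) = dstar b * dstar a.
Proof. by rewrite /dstar starM !mulrA mulrVK. Qed.

Let kappaV : kappa k^-1 * kappa k = 1.
Proof. by rewrite -kappaM mulrV // (qg_kappa1 hG). Qed.

Let kappaVr : kappa k * kappa k^-1 = 1.
Proof. by rewrite -kappaM mulVr // (qg_kappa1 hG). Qed.

Let tensC (a b : A) : (a ⊗ 1) * (1 ⊗ b) = (1 ⊗ b) * (a ⊗ 1) :> tensor A A.
Proof. by rewrite !tens_mul !mul1r !mulr1. Qed.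

Let tensVl : (k ⊗ 1) * (k^-1 ⊗ 1) = 1 :> tensor A A.
Proof. by rewrite tens_mul mulrV // mulr1. Qed.

Let tensVr : (1 ⊗ k^-1) * (1 ⊗ k) = 1 :> tensor A A.
Proof. by rewrite tens_mul mulVr // mulr1. Qed.

Let Delta_kl a : Delta (k * a) = (k ⊗ 1) * Delta a.
Proof. by case: kT => k1 k2; rewrite DeltaM k1 k2 -mulrA DDl. Qed.

Let Delta_kr a : Delta (a * k) = Delta a * (k ⊗ 1).
Proof. by case: kT => k1 k2; rewrite DeltaM k1 mulrA DDr. Qed.

Let Delta_kVr a : Delta (a * k^-1) = Delta a * (k^-1 ⊗ 1).
Proof. by case: kVT => k1 k2; rewrite DeltaM k1 mulrA DDr. Qed.

Let D_conj : (k ⊗ 1) * D * (k^-1 ⊗ 1) = D.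
Proof. by case: kT => _ <-; rewrite -mulrA tensVl mulr1. Qed.

Let dDeltaM : {morph dDelta : a b / a * b}.
Proof.
move=> a b; rewrite !dDeltaE mulrA; congr (_ * _).
rewrite -[in RHS](DDr a) -[in RHS](DDl b) DeltaM.
by rewrite -!mulrA (mulrA D (1 ⊗ _)) (mulrA (D * _)) D_kV_D DDl.
Qed.

Let tensor_dstar z :
  tensor_star dstar z = (k ⊗ k) * tensor_star star z * (k^-1 ⊗ k^-1).
Proof.
elim/tens_ind_add: z => [z1 z2|a b].
  by rewrite !tensor_starD tmulD_r tmulD_l => -> ->.
rewrite (tensor_star_tens dstarD dstarZ) (tensor_star_tens starD starZ).
by rewrite !tens_mul.
Qed.

Let dDelta_star a : dDelta (dstar a) = tensor_star dstar (dDelta a).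
Proof.
rewrite !dDeltaE tensor_dstar (tensor_starM starD starZ starM).
rewrite (tensor_star_tens starD starZ) (star1 starK starM) kVs.
rewrite -(wh_Delta_star hG) /dstar Delta_kVr Delta_kl.
have -> : (k ⊗ k) * ((1 ⊗ k^-1) * Delta (star a)) = (k ⊗ 1) * Delta (star a).
  by rewrite mulrA tens_mul mulr1 mulrV.
by rewrite -[LHS]mulrA tens_mul mulr1 mul1r.
Qed.

Let dcoassoc a :
  tassoc (tmap dDelta id (dDelta a)) = tmap id dDelta (dDelta a).
Proof.
have L z : tassoc (tmap dDelta id (z * (1 ⊗ k^-1))) =
    tassoc (tmap Delta id z) * (1 ⊗ (k^-1 ⊗ k^-1)).
  elim/tens_ind: z => [c z1 z2 IH1 IH2|u v].
    by rewrite tmulP_l !(tmap_linear, tassoc_linear) IH1 IH2 tmulP_l.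
  rewrite tens_mul mulr1 !tmap_tens_linear // dDeltaE -tassoc_tens -tassocM.
  by rewrite tens_mul.
have Rr z : tmap id dDelta (z * (1 ⊗ k^-1)) =
    tmap id Delta z * (1 ⊗ (k^-1 ⊗ k^-1)).
  elim/tens_ind: z => [c z1 z2 IH1 IH2|u v].
    by rewrite tmulP_l !tmap_linear IH1 IH2 tmulP_l.
  rewrite tens_mul !tmap_tens_linear // dDeltaE Delta_kVr -mulrA tens_mul.
  by rewrite tens_mul !mulr1 mul1r.
by rewrite dDeltaE L Rr (wh_coassoc hG).
Qed.

Let dkappa_star a : dkappa (dstar (dkappa (dstar a))) = a.
Proof.
have kk : kappa (kappa k) = k by rewrite kappa2_k // mulVr // mul1r.
(* Both sides have image k under the injective kappa, since k is self-adjoint and fixed by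
   kappa^2. *)
have skk : star (kappa k) = kappa k.
  by apply: (qg_kappa_inj hG); rewrite -[in LHS]ks (wh_kappa_star hG) kk.
have skkV : star (kappa k^-1) = kappa k^-1.
  have kkU : kappa k \is a GRing.unit by apply/unitrP; exists (kappa k^-1).
  have -> : kappa k^-1 = (kappa k)^-1 by rewrite -[RHS]mul1r -kappaV mulrK.
  by rewrite (starV starK starM kkU) skk.
have kkV : kappa (kappa k^-1) = k^-1 by rewrite kappa2_k // -mulrA mulVr // mulr1.
have -> : dstar (dkappa (dstar a)) = kappa k * star (kappa (star a)) * kappa k^-1.
  rewrite dkappaE /dstar !kappaM !starM kVs ks skk skkV !mulrA mulrV // mul1r.
  by rewrite mulrK.
rewrite dkappaE !kappaM kk kkV (wh_kappa_star hG) !mulrA mulrV // mul1r.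
by rewrite mulrK.
Qed.

Let dkappaM a b : dkappa (a * b) = dkappa b * dkappa a.
Proof. by rewrite !dkappaE kappaM !mulrA mulrVK. Qed.

Let dkappa_Delta a : tmap dkappa dkappa (dDelta a) = tflip (dDelta (dkappa a)).
Proof.
have dk2 z : tmap dkappa dkappa z = (k ⊗ k) * tmap kappa kappa z * (k^-1 ⊗ k^-1).
  move: z; apply: tens_ext => [|c z1 z2|u v]; first exact: tmap_linear.
    by rewrite tmap_linear tmulP_r tmulP_l.
  by rewrite !tmap_tens_linear // !dkappaE !tens_mul.
rewrite !dDeltaE dk2 dkappaE Delta_kVr Delta_kl tmap_antiM // tmap_tens_linear //.
rewrite (qg_kappa1 hG) (wh_kappa_Delta hG) !tflipM !tflip_tens.
(* The flipped form of (1 ⊗ k) Delta(1) = (kappa(k) ⊗ 1) Delta(1): a factor k in one leg is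
   compensated by kappa(k^-1) in the other. *)
have E z : (k ⊗ kappa k^-1) * tflip (Delta z) = tflip (Delta z).
  rewrite -(tflip_tens (kappa k^-1) k) -tflipM; congr tflip.
  rewrite -(DDl z) mulrA; congr (_ * _).
  transitivity ((kappa k^-1 ⊗ 1) * ((1 ⊗ k) * D)).
    by rewrite mulrA tens_mul mulr1 mul1r.
  by rewrite (target_mull hG kT) mulrA tens_mul kappaV mulr1 mul1r.
have -> : (k ⊗ k) * ((1 ⊗ kappa k^-1) * tflip (Delta (kappa a))) =
    (1 ⊗ k) * tflip (Delta (kappa a)).
  by rewrite -[in RHS]E !mulrA !tens_mul !mulr1 mul1r.
by rewrite -[RHS]mulrA tens_mul mulr1 mul1r.
Qed.

Let dantipode a :
  tmap (fun z => tmult (tmap dkappa id z)) id (tmap dDelta id (dDelta a)) =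
  (1 ⊗ a) * dDelta 1.
Proof.
(* The map u ⊗ v ↦ kappa(u) v with k^-1 inserted in the middle. As N(Delta(1)) = 1, the insertion
   disappears on Delta(1) z, in particular on every Delta(u). *)
pose N (z : tensor A A) := tlift (fun a b => kappa a * k^-1 * b) z.
have N_linear : linear N by exact: tlift_linear.
have N_tens u v : N (u ⊗ v) = kappa u * k^-1 * v.
  rewrite /N tlift_tens // => [z|z] c p r; last by rewrite mulrDr -scalerAr.
  by rewrite kappa_linear !mulrDl -!scalerAl.
have N_mul w u v : N (w * (u ⊗ v)) = kappa u * N w * v.
  elim/tens_ind: w => [c w1 w2 IH1 IH2|p r].
    by rewrite tmulP_l !N_linear IH1 IH2 mulrDr mulrDl -scalerAr -scalerAl.
  by rewrite tens_mul !N_tens kappaM !mulrA.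
have ND z : N (D * z) = antipode_mult kappa z.
  elim/tens_ind: z => [c z1 z2 IH1 IH2|u v].
    by rewrite tmulP_r N_linear antipode_mult_linear IH1 IH2.
  by rewrite N_mul [N D]expect_kV mulr1 antipode_mult_tens.
have dN z : tmult (tmap dkappa id (z * (1 ⊗ k^-1))) = k * N z * k^-1.
  elim/tens_ind: z => [c z1 z2 IH1 IH2|u v].
    rewrite tmulP_l tmap_linear tmult_linear IH1 IH2 N_linear.
    by rewrite mulrDr mulrDl -scalerAr -scalerAl.
  by rewrite tens_mul mulr1 tmap_tens_linear // tmult_tens dkappaE N_tens !mulrA.
have dm_linear : linear (fun z => tmult (tmap dkappa id z)).
  by move=> c u v; rewrite tmap_linear tmult_linear.
have E z : tmap (fun z => tmult (tmap dkappa id z)) id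
      (tmap dDelta id (z * (1 ⊗ k^-1))) =
    (k ⊗ 1) * tmap (antipode_mult kappa) id (tmap Delta id z) * (k^-1 ⊗ k^-1).
  elim/tens_ind: z => [c z1 z2 IH1 IH2|u v].
    by rewrite tmulP_l !tmap_linear IH1 IH2 tmulP_r tmulP_l.
  rewrite tens_mul mulr1 !tmap_tens_linear //; last exact: antipode_mult_linear.
  by rewrite dDeltaE dN !tens_mul mul1r -ND DDl.
rewrite !dDeltaE E [tmap (antipode_mult kappa) id _](wh_antipode hG) mulrA tensC.
rewrite -{1}[k^-1]mulr1 -{2}[k^-1]mul1r -tens_mul.
by rewrite -[in RHS]D_conj !mulrA.
Qed.

(** The root y splits k^-1 evenly: k a^* k^-1 a k = w^* w with w = y^-1 a k. *)
Let deps_ge0 a : 0 <= deps (dstar a * a) :> C.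
Proof.
have yU : y \is a GRing.unit by rewrite -(unitrX_pos y (n := 2)) // expr2 yy.
have kV : k^-1 = y^-1 * y^-1 by rewrite -yy invrM.
have := wh_eps_ge0 hG (y^-1 * a * k).
rewrite depsE /dstar !starM (starV starK starM yU) ys ks kV.
by rewrite !mulrA.
Qed.

Let dcounit_l a : tlift (fun u v => (deps u : C) *: v) (dDelta a) = a.
Proof.
have E z : tlift (fun u v => (deps u : C) *: v) (z * (1 ⊗ k^-1)) =
    tlift (fun u v => (eps u : C) *: v) (z * (k ⊗ 1)) * k^-1.
  elim/tens_ind: z => [c z1 z2 IH1 IH2|u v].
    by rewrite !tmulP_l !tlift_linear IH1 IH2 mulrDl scalerAl.
  by rewrite !tens_mul !tlift_scale_l // depsE !mulr1 scalerAl.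
by rewrite dDeltaE E -Delta_kr (wh_counit_l hG) mulrK.
Qed.

Let dcounit_r a : tlift (fun u v => (deps v : C) *: u) (dDelta a) = a.
Proof.
have E z : tlift (fun u v => (deps v : C) *: u) (z * (1 ⊗ k^-1)) =
    tlift (fun u v => (eps v : C) *: u) z.
  elim/tens_ind: z => [c z1 z2 IH1 IH2|u v].
    by rewrite tmulP_l !tlift_linear IH1 IH2.
  by rewrite tens_mul !tlift_scale_r // depsE ?mulr1 mulrVK.
by rewrite dDeltaE E (wh_counit_r hG).
Qed.

Let deps_mul a b :
  tlift (fun u v => deps u * deps v : C^o) ((a ⊗ 1) * dDelta 1 * (1 ⊗ b)) =
  deps (a * b).
Proof.
have E z : tlift (fun u v => deps u * deps v : C^o) z =
    tlift (fun u v => eps u * eps v : C^o) (z * (k ⊗ k)).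
  elim/tens_ind: z => [c z1 z2 IH1 IH2|u v].
    by rewrite tmulP_l !tlift_linear IH1 IH2.
  have mul_tens phi p r : linear phi ->
      tlift (fun u v : A => phi u * phi v : C^o) (p ⊗ r) = phi p * phi r.
    move=> phi_lin; apply: tlift_tens => [v'|u'] d p' r';
      by rewrite phi_lin /GRing.scale /=; ring.
  by rewrite tens_mul !mul_tens // !depsE.
have -> : deps (a * b) = eps (a * k * (k^-1 * b * k)).
  by rewrite depsE !mulrA mulrK.
rewrite E -(wh_eps_mul hG) dDeltaE; congr tlift.
rewrite tens1M -[in RHS](mulrA (a ⊗ 1)) -(proj2 kT) -!mulrA; congr (_ * (_ * _)).
by rewrite !tens_mul !mulr1 !mul1r mulrA.
Qed.

Lemma deformation_weak_hopf : weak_hopf dstar dDelta dkappa deps.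
Proof. by split. Qed.

Lemma target_deformation x : in_target dDelta x -> in_target Delta x.
Proof.
have cancelV : injective (fun z : tensor A A => z * (1 ⊗ k^-1)).
  by apply: (can_inj (g := fun z => z * (1 ⊗ k))) => z; rewrite -mulrA tensVr mulr1.
rewrite /in_target !dDeltaE -!mulrA -tensC !mulrA => -[x1 x2].
by split; apply: cancelV.
Qed.

Let kappa_kC z : in_target Delta z -> z * kappa k = kappa k * z.
Proof.
by move=> zT; apply: (target_source_comm hG zT); apply: source_kappa hG _ kT.
Qed.

Lemma dkappa2_target x : in_target dDelta x -> dkappa (dkappa x) = x.
Proof.
move=> /target_deformation xT; rewrite !dkappaE !kappaM kappa2_k //.
rewrite kappa_kC; last by do 2!apply: (targetM hG) => //.
by rewrite [kappa k^-1 * _]mulrA kappaV mul1r !mulrA mulrV // mul1r mulrK.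
Qed.

(** Combining the two conditions and cancelling 1 ⊗ k^-1 leaves Delta(x) = (1 ⊗ x) Delta(1), which
    places kappa(x) in A_t. Since kappa(k) lies in A_s, it commutes with kappa(x), and injectivity
    of kappa brings this back to x and k. *)
Lemma source_deformation x : in_source dDelta x ->
  in_target Delta (kappa x) /\ x * k = k * x.
Proof.
rewrite /in_source !dDeltaE => -[x1 x2]; rewrite x2 mulrA in x1.
have {}x1 : Delta x = (1 ⊗ x) * D.
  by rewrite -[LHS]mulr1 -tensVr mulrA x1 -[LHS]mulrA tensVr mulr1.
have kxT : in_target Delta (kappa x) by apply: (target_kappa_source hG).
split=> //; apply: (qg_kappa_inj hG); rewrite !kappaM.
by rewrite kappa_kC.
Qed.

(** kappa^2(x) = kappa(k) x kappa(k)^-1 is obtained by applying kappa and using the formula for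
    kappa^2 on kappa(x) in A_t. The factors kappa(k) then cancel, and x commutes with k. *)
Lemma dkappa2_source x : in_source dDelta x -> dkappa (dkappa x) = x.
Proof.
move=> /source_deformation[kxT xk]; rewrite !dkappaE !kappaM.
have kk : kappa (kappa k) = k by rewrite kappa2_k // mulVr // mul1r.
have kkV : kappa (kappa k^-1) = k^-1 by rewrite kappa2_k // -mulrA mulVr // mulr1.
have -> : kappa (kappa x) = kappa k * x * kappa k^-1.
  by apply: (qg_kappa_inj hG); rewrite kappa2_k // !kappaM kk kkV mulrA.
rewrite -[_ * kappa k^-1 * _]mulrA kappaV mulr1 mulrA kappaV mul1r.
by rewrite -xk mulrK.
Qed.

End Deformation.

(** * Matrix units *)

Section MatrixUnits.
Variables (F : numFieldType) (A : falgType F) (N : A -> Prop).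
Variables (r : nat) (n : 'I_r -> nat) (e : forall g, 'I_(n g) -> 'I_(n g) -> A).
Arguments e : clear implicits.
Hypothesis n_gt0 : forall g, (0 < n g)%N.
Hypothesis e_mul : forall g i j k l,
  e g i j * e g k l = if j == k then e g i l else 0.
Hypothesis e_mul0 : forall g h i j k l, g != h -> e g i j * e h k l = 0.
Hypothesis e_span : forall x, N x ->
  exists c : forall g, 'I_(n g) -> 'I_(n g) -> F,
  x = \sum_g \sum_i \sum_j c g i j *: e g i j.
Hypothesis N1 : N 1.

(** The diagonal sum is a left unit for each matrix unit, hence for 1, which lies in their span. *)
Lemma matrix_units_one : \sum_g \sum_i e g i i = 1.
Proof.
have unit_e h k l : (\sum_g \sum_i e g i i) * e h k l = e h k l.
  rewrite mulr_suml (bigD1 h) //= [X in _ + X]big1 => [|g gh].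
    rewrite addr0 mulr_suml (bigD1 k) //= e_mul eqxx big1 ?addr0 // => i ik.
    by rewrite e_mul (negPf ik).
  by rewrite mulr_suml big1 // => i _; rewrite e_mul0.
have [c c1] := e_span N1; rewrite -[LHS]mulr1 [in LHS]c1 [RHS]c1 mulr_sumr.
apply: eq_bigr => g _; rewrite mulr_sumr; apply: eq_bigr => i _.
rewrite mulr_sumr; apply: eq_bigr => j _.
by rewrite -scalerAr unit_e.
Qed.

(** Serves both as the normalization required by [frame_casimir] and as E(1) = 1 in the
    admissibility of q. *)
Lemma matrix_units_index :
  \sum_g \sum_i \sum_j (n g)%:R^-1 *: (e g i j * e g j i) = 1.
Proof.
rewrite -matrix_units_one; apply: eq_bigr => g _; apply: eq_bigr => i _.
under eq_bigr do rewrite e_mul eqxx.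
rewrite sumr_const card_ord -scaler_nat scalerA mulfV ?scale1r //.
by rewrite pnatr_eq0 -lt0n.
Qed.

Lemma matrix_units_casimir z : N z ->
  \sum_g \sum_i \sum_j (n g)%:R^-1 *: ((e g i j * z) ⊗ e g j i) =
  \sum_g \sum_i \sum_j (n g)%:R^-1 *: (e g i j ⊗ (z * e g j i)).
Proof.
move=> /e_span[c ->]; pose L z := \sum_g \sum_i \sum_j
  (n g)%:R^-1 *: ((e g i j * z) ⊗ e g j i).
pose M z := \sum_g \sum_i \sum_j (n g)%:R^-1 *: (e g i j ⊗ (z * e g j i)).
have L_linear : linear L.
  move=> a u v; rewrite /L scaler_sumr -big_split; apply: eq_bigr => g _ /=.
  rewrite scaler_sumr -big_split; apply: eq_bigr => i _ /=.
  rewrite scaler_sumr -big_split; apply: eq_bigr => j _ /=.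
  by rewrite mulrDr -scalerAr tens_linear_l scalerDr !scalerA mulrC.
have M_linear : linear M.
  move=> a u v; rewrite /M scaler_sumr -big_split; apply: eq_bigr => g _ /=.
  rewrite scaler_sumr -big_split; apply: eq_bigr => i _ /=.
  rewrite scaler_sumr -big_split; apply: eq_bigr => j _ /=.
  by rewrite mulrDl -scalerAl tens_linear_r scalerDr !scalerA mulrC.
suff LM h k l : L (e h k l) = M (e h k l).
  rewrite -/(L _) -/(M _).
  rewrite (linear_sum_map _ _ L_linear) (linear_sum_map _ _ M_linear).
  apply: eq_bigr => h _.
  rewrite (linear_sum_map _ _ L_linear) (linear_sum_map _ _ M_linear).
  apply: eq_bigr => k _.
  rewrite (linear_sum_map _ _ L_linear) (linear_sum_map _ _ M_linear).
  apply: eq_bigr => l _.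
  by rewrite (linear_scale_map _ _ L_linear) (linear_scale_map _ _ M_linear) LM.
(* By linearity z is a single matrix unit e h k l; only j = k survives on the left and only j = l on
   the right, with this common value. *)
transitivity (\sum_i (n h)%:R^-1 *: (e h i l ⊗ e h k i)).
  rewrite /L (bigD1 h) //= [X in _ + X]big1 ?addr0 => [|g gh].
    apply: eq_bigr => i _; rewrite (bigD1 k) //= e_mul eqxx big1 ?addr0 // => j jk.
    by rewrite e_mul (negPf jk) tens0l scaler0.
  by do 2![rewrite big1 // => ? _]; rewrite e_mul0 // tens0l scaler0.
rewrite /M (bigD1 h) //= [X in _ + X]big1 ?addr0 => [|g gh].
  apply: eq_bigr => i _; rewrite (bigD1 l) //= e_mul eqxx big1 ?addr0 // => j jl.
  by rewrite e_mul eq_sym (negPf jl) tens0r scaler0.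
by do 2![rewrite big1 // => ? _]; rewrite e_mul0 1?eq_sym // tens0r scaler0.
Qed.

End MatrixUnits.

(** * Existence of the deformation and return to C*-algebras *)

Lemma sum_matrix_index (V : nmodType) (r : nat) (n : 'I_r -> nat)
    (G : forall g, 'I_(n g) -> 'I_(n g) -> V) :
  \sum_g \sum_i \sum_j G g i j =
  \sum_(p : {g : 'I_r & ('I_(n g) * 'I_(n g))%type})
    G (tag p) (tagged p).1 (tagged p).2.
Proof.
under eq_bigr do rewrite pair_bigA.
exact: sig_big_dep.
Qed.

(** Gathers the algebraic content of the theorem over a general closed field, with a self-adjoint
    square root of q kept for the later transport of the norm. *)
Lemma canonical_deformation (C : numClosedFieldType) (A : falgType C)
    (star : A -> A) (Delta : 'Hom(A, tensor A A)) (kappa : 'End(A))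
    (eps : 'Hom(A, C^o)) : weak_hopf star Delta kappa eps ->
  exists q : A, [/\ in_target Delta q, q \is a GRing.unit, kappa (kappa q) = q,
    exists2 y, star y = y & y * y = q &
    [/\ forall (r : nat) (n : 'I_r -> nat)
          (e : forall g, 'I_(n g) -> 'I_(n g) -> A),
        (forall g, (0 < n g)%N) ->
        (forall g i j, in_target Delta (e g i j)) ->
        (forall g i j k l, e g i j * e g k l = if j == k then e g i l else 0) ->
        (forall g h i j k l, g != h -> e g i j * e h k l = 0) ->
        (forall x, in_target Delta x ->
           exists c : forall g, 'I_(n g) -> 'I_(n g) -> C,
             x = \sum_g \sum_i \sum_j c g i j *: e g i j) ->
        Delta 1 = \sum_g \sum_i \sum_j
          (n g)%:R^-1 *: ((kappa^-1)%VF (e g i j * q) ⊗ e g j i),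
      weak_hopf (dstar star q) (dDelta Delta q) (dkappa kappa q) (deps eps q),
      forall x, in_target (dDelta Delta q) x ->
        dkappa kappa q (dkappa kappa q x) = x &
      forall x, in_source (dDelta Delta q) x ->
        dkappa kappa q (dkappa kappa q x) = x]].
Proof.
move=> hG; have [F FT FE] := target_frame hG.
pose q := canonical star F.
have [qU [y [_ ys yy]]] := canonical_sqrt hG FT FE.
have qT := target_canonical hG FT.
have kappa2 z := kappa2_target hG FT FE (z := z).
(* On \sum kappa^-1(f) ⊗ f^* this expression is \sum f q^-1 f^*, which [canonical_expect]
   evaluates. *)
have expect : tlift (fun a b => kappa a * q^-1 * b) (Delta 1) = 1.
  rewrite -[RHS](canonical_expect hG FT FE) (Delta1_frame hG FT FE).
  rewrite (linear_sum_map _ _ (tlift_linear _)); apply: eq_bigr => f _.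
  rewrite tlift_tens ?(kappa_invK hG) // => [b|a] c u v.
    by rewrite linearP !mulrDl -!scalerAl.
  by rewrite mulrDr -scalerAr.
have DqD := Delta1_canonical hG FT FE.
have qq : kappa (kappa q) = q := kappa2_canonical hG FT FE.
exists q; split=> //.
  by exists y.
split=> [r n e n0 eT eM eM0 eS|||].
- have N1 := target1 Delta.
  rewrite [LHS](frame_casimir hG FT FE
    (a := fun p : {g : 'I_r & ('I_(n g) * 'I_(n g))%type} =>
      (n (tag p))%:R^-1 *: e (tag p) (tagged p).1 (tagged p).2)
    (b := fun p => e (tag p) (tagged p).2 (tagged p).1)) //; first last.
  + rewrite -(matrix_units_index n0 eM eM0 eS N1) sum_matrix_index.
    by apply: eq_bigr => p _; rewrite scalerAl.
  + move=> z zT; have := matrix_units_casimir eM eM0 eS zT.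
    rewrite !sum_matrix_index => E; rewrite [RHS](eq_bigr _ (fun p _ => tensZl _ _ _)).
    by rewrite -E; apply: eq_bigr => p _; rewrite -scalerAl tensZl.
  rewrite sum_matrix_index; apply: eq_bigr => p _.
  by rewrite (kappa_inv_lfun hG) -scalerAl -tensZl -!(kappa_inv_lfun hG) linearZ.
- exact (deformation_weak_hopf hG qT qU ys yy kappa2 DqD expect).
- exact (dkappa2_target hG qT qU kappa2).
exact (dkappa2_source hG qT qU kappa2).
Qed.

Lemma weak_hopf_of_quantum_groupoid (R : realType) (A : falgType R[i])
    (star : A -> A) (Delta : 'Hom(A, tensor A A)) (kappa : 'End(A))
    (eps : 'Hom(A, (R[i])^o)) :
  is_quantum_groupoid star Delta kappa eps ->
  @weak_hopf R[i] A star Delta kappa eps.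
Proof.
case=> -[sD sZ sK sM _] DM Ds Dc ks kM kD ap ep cl cr em.
split; [exact sD|exact sZ|exact sK|exact sM|exact DM|exact Ds|exact Dc|exact ks
 |exact kM|exact kD|exact ap| |exact cl|exact cr|exact em].
by move=> x; apply: ep; exists x.
Qed.

Lemma deform_star_cstar (R : realType) (A : falgType R[i]) (star : A -> A)
    (k y : A) : is_cstar_algebra star -> k \is a GRing.unit -> star y = y ->
  y * y = k -> is_cstar_algebra (deform_star star k).
Proof.
move=> [sD sZ sK sM [nrm [n0 nE nD nZ nM nS]]] kU ys yy.
have s1 : star 1 = 1 by exact: star1 sK sM.
have ks : star k = k by rewrite -yy sM ys.
have kVs : star k^-1 = k^-1 by rewrite (starV sK sM kU) ks.
have yU : y \is a GRing.unit by rewrite -(unitrX_pos y (n := 2)) // expr2 yy.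
have yVs : star y^-1 = y^-1 by rewrite (starV sK sM yU) ys.
(* [phi] carries the deformed involution to [star], and the norm is pulled back
   along it. *)
pose phi a := y^-1 * a * y.
have phiM a b : phi (a * b) = phi a * phi b by rewrite /phi !mulrA mulrK.
have phi_star a : phi (deform_star star k a) = star (phi a).
  rewrite /phi /deform_star !sM yVs ys -yy invrM // !mulrA mulVr // mul1r.
  by rewrite mulrVK.
have phi_eq0 a : phi a = 0 -> a = 0.
  move=> a0; rewrite -[a](mulVKr yU) -[y^-1 * a](mulrK yU).
  by rewrite -/(phi a) a0 mul0r mulr0.
split.
- by move=> a b; rewrite /deform_star sD mulrDr mulrDl.
- by move=> c a; rewrite /deform_star sZ -scalerAr -scalerAl.
- move=> a; rewrite /deform_star !sM sK ks kVs !mulrA mulrV // mul1r.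
  by rewrite mulrK.
- by move=> a b; rewrite /deform_star sM !mulrA mulrVK.
exists (nrm \o phi); split=> /=.
- by move=> a; apply: n0.
- by move=> a /nE/phi_eq0.
- by move=> a b; rewrite /phi mulrDr mulrDl; apply: nD.
- by move=> c a; rewrite /phi -scalerAr -scalerAl; apply: nZ.
- by move=> a b; rewrite phiM; apply: nM.
by move=> a; rewrite phiM phi_star nS.
Qed.

Theorem corollary2p7 (R : realType) (A : falgType R[i]) (star : A -> A)
    (Delta : 'Hom(A, tensor A A)) (kappa : 'End(A)) (eps : 'Hom(A, (R[i])^o))
    (hG : is_quantum_groupoid star Delta kappa eps) :
  exists k : A,
    [/\ admissible star Delta kappa k,
        is_quantum_groupoid (deform_star star k) (deform_Delta Delta k)
          (deform_kappa kappa k) (deform_eps eps k),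
        forall x, target (deform_Delta Delta k) x ->
          deform_kappa kappa k (deform_kappa kappa k x) = x &
        forall x, source (deform_Delta Delta k) x ->
          deform_kappa kappa k (deform_kappa kappa k x) = x].
Proof.
have [q [qT qU qk [y ys yy] [qcan
    [sD sZ sK sM DM Ds Dc ks kM kD ap ep cl cr em] tq sq]]] :=
  canonical_deformation (weak_hopf_of_quantum_groupoid hG).
exists q; split; [|split|exact tq|exact sq].
- split; [exact qT|by exists y; rewrite ys yy|exact qU|exact qk|].
  exists q.
    split; [exact qT|exact qU|].
    move=> r n e [n0 eN _ _ eM eM0 eS]; exact (qcan r n e n0 eN eM eM0 eS).
  move=> r n e [n0 eN _ _ eM eM0 eS]; rewrite mulVr // /center_expectation.
  rewrite -[RHS](matrix_units_index n0 eM eM0 eS (target1 Delta)).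
  apply: eq_bigr => g _; apply: eq_bigr => i _; apply: eq_bigr => j _.
  by rewrite mulr1.
- exact (deform_star_cstar (qg_cstar hG) qU ys yy).
- exact DM.
- exact Ds.
- exact Dc.
- exact ks.
- exact kM.
- exact kD.
- exact ap.
- move=> _ [x ->]; exact (ep x).
- exact cl.
- exact cr.
exact em.
Qed.
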